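(* Let $\mu,k$ be integers with $k\ge0$ and $\mu-2k\ge1$. For a partition $\underline{\lambda}$, one has $\mathcal{D}(\underline{\lambda})=(\mu,\mu-2,\mu-4,\ldots,\mu-2k)$ if and only if $\underline{\lambda}=(\mu,\mu-2,\mu-4,\ldots,\mu-2k+2,\,r(\mu-2k,t))$ for some $t\in\{1,2,\ldots,\mu-2k\}$. Consequently $|\mathcal{D}^{-1}(\mu,\mu-2,\ldots,\mu-2k)|=\mu-2k$.
   Context: $\mathbb{F}$ is an algebraically closed field of characteristic $0$. For a nilpotent matrix $A$, $\mathrm{sh}(A)$ is the partition of $n$ given by its Jordan block sizes; $\mathcal{O}_{\underline{\mu}}$ is the set of nilpotent $n\times n$ matrices of shape $\underline{\mu}$; $\mathcal{N}_B$ is the set of nilpotent matrices commuting with $B$. Partitions of $n$ are ordered by dominance: $(\lambda_1,\ldots,\lambda_t)\le(\mu_1,\ldots,\mu_s)$ iff $\sum_{i\le k}\lambda_i\le\sum_{i\le k}\mu_i$ for all $k$. For a partition $\underline{\lambda}$ of $n$, $\mathcal{D}(\underline{\lambda})$ is the unique maximal partition $\underline{\mu}$ of $n$ such that $\mathcal{O}_{\underline{\mu}}\cap\mathcal{N}_B\neq\emptyset$ for $B$ of shape $\underline{\lambda}$ (equivalently, the shape of a generic element of the irreducible variety $\mathcal{N}_B$). For $1\le t\le m$, $r(m,t)$ is the unique partition of $m$ with exactly $t$ parts whose largest and smallest parts differ by at most $1$ (an almost rectangular partition). *)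

(* Defs.v *)
From HB Require Import structures.
From mathcomp Require Import all_boot all_order all_algebra.
Set Implicit Arguments. Unset Strict Implicit. Unset Printing Implicit Defensive.
Import GRing.Theory.

Definition is_partition (lam : seq nat) : bool :=
  sorted geq lam && all (fun x => 0 < x) lam.

Definition dominated (lam mu : seq nat) : Prop :=
  forall k, sumn (take k lam) <= sumn (take k mu).

Definition block_starts (lam : seq nat) : seq nat :=
  [seq sumn (take k lam) | k <- iota 0 (size lam)].

(* The nilpotent Jordan matrix (block diagonal, nilpotent Jordan blocks of sizes
   given by lam, ones on the superdiagonal inside each block). *)
Definition jordan_nil (F : fieldType) (n : nat) (lam : seq nat) : 'M[F]_n :=
  \matrix_(i < n, j < n)
     ((((j : nat) == i.+1) && (i.+1 \notin block_starts lam))%:R)%R.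

Definition has_shape (F : fieldType) (n : nat) (A : 'M[F]_n) (lam : seq nat) : Prop :=
  is_partition lam /\ sumn lam = n /\
  exists P : 'M[F]_n, P \in unitmx /\ (A = invmx P *m jordan_nil F n lam *m P)%R.

Definition nilpotent_mx (F : fieldType) (n : nat) (A : 'M[F]_n) : Prop :=
  exists k, (A ^+ k = 0)%R.

Definition in_NB (F : fieldType) (n : nat) (B A : 'M[F]_n) : Prop :=
  nilpotent_mx A /\ (A *m B = B *m A)%R.

(* D(lam) = mu : mu is the (unique) maximal partition mu of n with
   O_mu ∩ N_B nonempty, for B of shape lam. *)
Definition D_is (F : fieldType) (lam mu : seq nat) : Prop :=
  is_partition lam /\ is_partition mu /\ sumn mu = sumn lam /\
  forall B : 'M[F]_(sumn lam), has_shape B lam ->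
    (exists A, in_NB B A /\ has_shape A mu) /\
    (forall nu, (exists A, in_NB B A /\ has_shape A nu) -> dominated nu mu).

Definition almost_rect (m t : nat) (p : seq nat) : Prop :=
  is_partition p /\ sumn p = m /\ size p = t /\ head 0 p - last 0 p <= 1.

(* Main.v *)
Require Import Defs.
From HB Require Import structures.
From mathcomp Require Import all_boot all_order all_algebra.
From mathcomp Require Import fingroup perm zify.
Set Implicit Arguments. Unset Strict Implicit. Unset Printing Implicit Defensive.
Import GRing.Theory.

(* A matrix commuting with the Jordan matrix J of shape lam is supported on the
   order on the cells (part, position) of lam in which the distance to the start of
   the part increases and the distance to its end decreases; a nilpotent one becomes
   strictly triangular for this order after a change of basis inside the classes of
   cells with the same two distances.

   If lam = (mu, mu-2, .., mu-2k+2, r(m,t)) with m = mu-2k, the cells can be put on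
   mu levels, with at most k+1 cells on each, so that the order strictly increases
   levels; counting the cells on the first i and last i levels gives
   rank A^(mu-2i) <= i(i+1), i.e. sh(A) <= (mu, mu-2, .., mu-2k). The bound is attained
   because J_m^t has shape r(m,t).

   Conversely, let D(lam) = (mu, mu-2, .., mu-2k). The 0/1 matrix of the strict order on
   cells commutes with J and is nilpotent, and in characteristic 0 its L-th power is
   nonzero if the order has a chain of L+1 cells. Hence for every q the U-chain made of
   all cells of the parts q and q+1 and of the first and last cells of the larger
   parts has at most mu elements. Grouping the parts of lam greedily into r almost
   rectangular groups and summing these bounds gives n + r(r-1) <= r mu, with equality
   only for the announced lam. The largest parts of the groups differ by at least 2, so
   they carry an antichain of r cells, which forces rank A <= n - r for all A in N_B;
   so r <= k+1, and n = (k+1)(mu-k) leaves only r = k+1 and equality. *)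

(** * Cells of a partition and the nilpotent Jordan matrix *)

(* The i-th basis vector of jordan_nil lies in the block number blk lam i, off lam i
   places after the start of the block and coff lam i places before its end. *)
Fixpoint blk (lam : seq nat) (i : nat) : nat :=
  if lam is p :: l then if i < p then 0 else (blk l (i - p)).+1 else 0.

Fixpoint off (lam : seq nat) (i : nat) : nat :=
  if lam is p :: l then if i < p then i else off l (i - p) else 0.

Fixpoint coff (lam : seq nat) (i : nat) : nat :=
  if lam is p :: l then if i < p then p.-1 - i else coff l (i - p) else 0.

Lemma off0 lam : off lam 0 = 0.
Proof. by elim: lam => //= p l IH; case: p. Qed.

Lemma cell_last lam i : i.+1 = sumn lam -> coff lam i = 0.
Proof.
elim: lam i => //= p l IH i; case: ifP => [ip|ip] E; first lia.
by apply: IH; lia.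
Qed.

Lemma coff_bound lam i : i < sumn lam -> i + coff lam i < sumn lam.
Proof.
elim: lam i => //= p l IH i; case: (ltnP i p) => ip il; first by lia.
have := IH (i - p); lia.
Qed.

Lemma off_next lam i : i.+1 < sumn lam ->
  off lam i.+1 = if 0 < coff lam i then (off lam i).+1 else 0.
Proof.
elim: lam i => //= p l IH i; case: (ltnP i p) => ip il.
  case: (ltnP i.+1 p) => ip'; first by rewrite ifT //; lia.
  have -> : i.+1 - p = 0 by lia.
  by rewrite off0; case: ifP => // ?; lia.
have -> : (i.+1 < p) = false by lia.
rewrite subSn // IH //; lia.
Qed.

Lemma coff_next lam i : i.+1 < sumn lam -> 0 < coff lam i ->
  coff lam i.+1 = (coff lam i).-1.
Proof.
elim: lam i => //= p l IH i; case: (ltnP i p) => ip il; first by case: (ltnP i.+1 p) => ip'; lia.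
have -> : (i.+1 < p) = false by lia.
rewrite subSn // => c0; rewrite IH //; lia.
Qed.

Lemma blk_next lam i : i.+1 < sumn lam -> 0 < coff lam i ->
  blk lam i.+1 = blk lam i.
Proof.
elim: lam i => //= p l IH i; case: (ltnP i p) => ip il; first by case: (ltnP i.+1 p) => ip'; lia.
have -> : (i.+1 < p) = false by lia.
rewrite subSn // => c0; rewrite IH //; lia.
Qed.

Lemma cell_size lam i : i < sumn lam ->
  (off lam i + coff lam i).+1 = nth 0 lam (blk lam i) /\ blk lam i < size lam.
Proof.
elim: lam i => //= p l IH i; case: (ltnP i p) => ip il; first by split=> //=; lia.
by apply: IH; lia.
Qed.

Lemma cell_index lam i : i < sumn lam ->
  i = sumn (take (blk lam i) lam) + off lam i.
Proof.
elim: lam i => //= p l IH i; case: (ltnP i p) => ip il //=.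
by rewrite -addnA -IH //; lia.
Qed.

Lemma cell_exists lam e p : p \in lam -> e < p ->
  exists i, [/\ i < sumn lam, off lam i = e & coff lam i = p.-1 - e].
Proof.
elim: lam => //= q l IH; rewrite inE => /orP[/eqP <-|pl] ep.
  by exists e; rewrite ep; split => //; lia.
have [i [il io ic]] := IH pl ep; exists (q + i).
by rewrite ltn_add2l il ltnNge leq_addr addKn.
Qed.

Lemma cell_cat l1 l2 i : i < sumn (l1 ++ l2) ->
  (i < sumn l1 -> [/\ blk (l1 ++ l2) i = blk l1 i, off (l1 ++ l2) i = off l1 i
     & coff (l1 ++ l2) i = coff l1 i])
  /\ (sumn l1 <= i -> [/\ blk (l1 ++ l2) i = size l1 + blk l2 (i - sumn l1),
       off (l1 ++ l2) i = off l2 (i - sumn l1)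
     & coff (l1 ++ l2) i = coff l2 (i - sumn l1)]).
Proof.
elim: l1 i => [|p l IH] i /=; first by rewrite subn0.
case: (ltnP i p) => ip il; first by split=> h //; lia.
have [] := IH (i - p); first by lia.
have -> : i - p - sumn l = i - (p + sumn l) by lia.
by move=> h1 h2; split=> h; [case: h1 => [|-> -> ->] | case: h2 => [|-> -> ->]]; rewrite ?addSn; try lia.
Qed.

Lemma cell_sum lam (f : nat -> nat -> nat -> nat) :
  \sum_(i < sumn lam) f (blk lam i) (off lam i) (coff lam i) =
  \sum_(b < size lam) \sum_(e < nth 0 lam b) f b e ((nth 0 lam b).-1 - e).
Proof.
elim: lam f => [|p l IH] f; first by rewrite !big_ord0.
rewrite big_ord_recl /= big_split_ord /=; congr (_ + _).
  by apply: eq_bigr => i _; rewrite ltn_ord.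
rewrite -(IH (fun b => f b.+1)); apply: eq_bigr => i _.
by rewrite ltnNge leq_addr addKn.
Qed.

Lemma cell_sum_parts lam (f : nat -> nat -> nat) :
  \sum_(i < sumn lam) f (off lam i) (coff lam i) =
  \sum_(p <- lam) \sum_(e < p) f e (p.-1 - e).
Proof. by rewrite (cell_sum lam (fun _ => f)) (big_nth 0) big_mkord. Qed.

Lemma blk_mono lam i j : i <= j -> j < sumn lam -> blk lam i <= blk lam j.
Proof.
elim: lam i j => //= p l IH i j ij jl; case: (ltnP i p) => // ip.
have -> : (j < p) = false by lia.
by move=> *; rewrite ltnS IH ?leq_sub2r //; lia.
Qed.

Lemma off_le lam i : off lam i <= i.
Proof.
elim: lam i => //= p l IH i; case: ltnP => // _.
exact: leq_trans (IH _) (leq_subr _ _).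
Qed.

(** An index starts a block exactly when the cell before it ends one. The hypothesis leaves out the
    index [sumn lam], which lies beyond the last cell. *)
Lemma block_startsE lam i : i.+1 < sumn lam ->
  (i.+1 \notin block_starts lam) = (0 < coff lam i).
Proof.
elim: lam i => //= p l IH i il.
have -> : block_starts (p :: l) = 0 :: [seq p + s | s <- block_starts l].
  by rewrite /block_starts /= (iotaDl 1) -!map_comp.
rewrite inE /=; case: (ltnP i p) => ip; last first.
  rewrite -IH; last lia; congr (~~ _); apply/mapP/idP => [[s sl E]|h].
    by have -> : (i - p).+1 = s by lia.
  by exists (i - p).+1 => //; lia.
apply/idP/idP => [/mapP h|h]; last by apply/mapP => -[s sl]; lia.
case: (posnP (p.-1 - i)) => // E; case: h; exists 0; last lia.
case: (l) il => [|q r] /=; first lia.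
by rewrite /block_starts /= inE eqxx.
Qed.

(** * Powers and centralizer of the nilpotent Jordan matrix *)

Section JordanNil.
Variables (F : fieldType) (n : nat) (lam : seq nat) (hn : sumn lam = n).
Local Open Scope ring_scope.
Local Notation J := (jordan_nil F n lam).

Lemma jordan_nilE (i j : 'I_n) :
  J i j = ((j == i.+1 :> nat) && (0 < coff lam i)%N)%:R.
Proof.
rewrite mxE; case: eqP => //= E; rewrite block_startsE // hn -E; exact: ltn_ord.
Qed.

Lemma jordan_nilXE a (i j : 'I_n) :
  (J ^+ a) i j = ((j == i + a :> nat)%N && (a <= coff lam i)%N)%:R.
Proof.
elim: a i => [|a IH] i; first by rewrite expr0 mxE addn0 andbT eq_sym.
rewrite exprS mxE.
have [c0|c0] := posnP (coff lam i).
  rewrite c0 andbF big1 // => z _.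
  by rewrite jordan_nilE c0 andbF mul0r.
have iS : (i.+1 < n)%N.
  rewrite ltn_neqAle ltn_ord andbT; apply/eqP => E.
  by move: c0; rewrite cell_last // hn.
rewrite (bigD1 (Ordinal iS)) //= big1 ?addr0 => [|z zi].
  rewrite jordan_nilE eqxx c0 mul1r IH /= addSnnS coff_next ?hn //.
  by congr ((_ && _)%:R); lia.
rewrite jordan_nilE; case: eqP => [E|]; last by rewrite mul0r.
by case/eqP: zi; apply: val_inj.
Qed.

(** [pick] finds the predecessor of [j] in its block, if there is one: right multiplication by [J]
    shifts columns and clears those at block starts. *)
Lemma mul_jordan_nil (A : 'M[F]_n) (i j : 'I_n) :
  (A *m J) i j = if [pick j' : 'I_n | (j == j'.+1 :> nat) && (0 < coff lam j')%N] is Some j'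
                 then A i j' else 0.
Proof.
rewrite mxE; case: pickP => [z /andP[/eqP Ej c0]|h]; last first.
  by rewrite big1 // => z _; rewrite jordan_nilE h mulr0.
rewrite (bigD1 z) //= big1 ?addr0 => [|y yz]; first by rewrite jordan_nilE Ej eqxx c0 mulr1.
rewrite jordan_nilE; case: eqP => [E|]; last by rewrite mulr0.
by case/eqP: yz; apply: val_inj; move: E; rewrite Ej => -[].
Qed.

Lemma jordan_nil_mul (A : 'M[F]_n) (i j : 'I_n) :
  (J *m A) i j = if [pick i' : 'I_n | (i' == i.+1 :> nat) && (0 < coff lam i)%N] is Some i'
                 then A i' j else 0.
Proof.
rewrite mxE; case: pickP => [z /andP[/eqP Ej c0]|h]; last first.
  by rewrite big1 // => z _; rewrite jordan_nilE h mul0r.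
rewrite (bigD1 z) //= big1 ?addr0 => [|y yz]; first by rewrite jordan_nilE Ej eqxx c0 mul1r.
rewrite jordan_nilE; case: eqP => [E|]; last by rewrite mul0r.
by case/eqP: yz; apply: val_inj; rewrite /= Ej E.
Qed.

Lemma next_cell (i : 'I_n) : (0 < coff lam i)%N ->
  exists2 i' : 'I_n, i' = i.+1 :> nat &
    [/\ off lam i' = (off lam i).+1, coff lam i' = (coff lam i).-1
      & blk lam i' = blk lam i].
Proof.
move=> c0; have iS : (i.+1 < n)%N.
  rewrite ltn_neqAle ltn_ord andbT; apply/eqP => E.
  by move: c0; rewrite cell_last // hn.
by exists (Ordinal iS) => //=; rewrite off_next ?coff_next ?blk_next ?hn // c0.
Qed.

Lemma prev_cell (i : 'I_n) : (0 < off lam i)%N ->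
  exists2 i' : 'I_n, i = i'.+1 :> nat & (0 < coff lam i')%N.
Proof.
move=> o0; have i0 : (0 < i)%N by rewrite lt0n; apply/eqP => E; rewrite E off0 in o0.
have ip : (i.-1 < n)%N by apply: leq_ltn_trans (leq_pred _) (ltn_ord i).
exists (Ordinal ip); first by rewrite /= prednK.
rewrite /= lt0n; apply/eqP => c0.
by move: o0; rewrite -(prednK i0) off_next ?c0 // prednK // hn.
Qed.

(* [off] and [coff] are monotone along the nonzero entries: these say that A
   preserves the images and the kernels of the powers of J. *)
Lemma comm_jordan_nil_entry (A : 'M[F]_n) (i j : 'I_n) :
  A *m J = J *m A -> A i j != 0 ->
  (off lam i <= off lam j)%N && (coff lam j <= coff lam i)%N.
Proof.
move=> /matrixP com; apply: contraR; rewrite negb_and -!ltnNge => /orP[h|h].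
  (* Position [(i - 1, j)] of [A J = J A] gives [A i j = A (i - 1) (j - 1)], or 0 when [j] starts
     its block; going back, [j] reaches a start before [i] does. *)
  have [m] := ubnP (off lam j); elim: m i j h => // m IH i j h jm.
  have [|i' Ei ci] := @prev_cell i; first exact: leq_ltn_trans h.
  have := com i' j; rewrite mul_jordan_nil jordan_nil_mul.
  case: pickP => [j' /andP[/eqP Ej cj]|_]; case: pickP => [z /andP[/eqP Ez _]|hz].
  - have -> : z = i by apply: val_inj; rewrite /= Ei.
    move=> <-; apply/eqP/eqP; apply: IH.
      have := @off_next lam i'; have := @off_next lam j'.
      by rewrite -Ei -Ej hn !ltn_ord ci cj => h1 h2; rewrite h1 // h2 // in h *.
    by have := @off_next lam j'; rewrite -Ej hn ltn_ord cj => h1; rewrite h1 // in jm.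
  - by have := hz i; rewrite Ei eqxx ci.
  - by have -> : z = i by [apply: val_inj; rewrite /= Ei]; move=> <-.
  - by have := hz i; rewrite Ei eqxx ci.
(* Symmetrically [A i j = A (i + 1) (j + 1)], or 0 when [i] ends its block, which happens before [j]
   ends its own. *)
have [m] := ubnP (coff lam i); elim: m i j h => // m IH i j h im.
have [|j' Ej [_ cj _]] := @next_cell j; first exact: leq_ltn_trans h.
have := com i j'; rewrite mul_jordan_nil jordan_nil_mul.
case: pickP => [z /andP[/eqP Ez _]|hz]; last first.
  by have := hz j; rewrite Ej eqxx (leq_ltn_trans _ h).
have -> : z = j by apply: val_inj; move: Ez; rewrite /= Ej => -[].
move=> ->; case: pickP => [i' /andP[/eqP Ei ci]|//].
have ci' : coff lam i' = (coff lam i).-1 by rewrite Ei coff_next // hn -Ei.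
by apply: IH; rewrite ci' ?cj; lia.
Qed.

(** The three conditions are the entrywise equality of [A J] and [J A] where both shifts exist,
    where only the row shift exists, and where only the column shift exists. *)
Lemma comm_jordan_nilP (a : nat -> nat -> F) :
  (forall i j i' j' : 'I_n, i' = i.+1 :> nat -> j' = j.+1 :> nat ->
     (0 < coff lam i)%N -> (0 < coff lam j)%N -> a i j = a i' j') ->
  (forall i j : 'I_n, (0 < off lam i)%N -> off lam j = 0%N -> a i j = 0) ->
  (forall i j : 'I_n, coff lam i = 0%N -> (0 < coff lam j)%N -> a i j = 0) ->
  let A := \matrix_(i < n, j < n) a i j in A *m J = J *m A.
Proof.
move=> h1 h2 h3 A; apply/matrixP => i j; rewrite mul_jordan_nil jordan_nil_mul.
case: pickP => [j' /andP[/eqP Ej cj]|hj]; case: pickP => [i' /andP[/eqP Ei ci]|hi].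
- by rewrite !mxE; apply: h1.
- rewrite mxE h3 //; apply/eqP; rewrite -leqn0 leqNgt; apply/negP => ci.
  by have [i' Ei _] := next_cell ci; move: (hi i'); rewrite Ei eqxx ci.
- rewrite mxE h2 //; first by rewrite Ei off_next ?ci // hn -Ei ltn_ord.
  apply/eqP; rewrite -leqn0 leqNgt; apply/negP => cj.
  by have [j' Ej cj'] := prev_cell cj; move: (hj j'); rewrite Ej eqxx cj'.
- by [].
Qed.

End JordanNil.

(** * Ranks *)

Section Rank.
Local Open Scope ring_scope.
Variables (F : fieldType) (n : nat).
Implicit Types (M : 'M[F]_n) (K : {set 'I_n}).

Definition coord_mx K : 'M[F]_n := \matrix_(i, j) ((i == j) && (i \in K))%:R.

Lemma coord_mxl K M i j : (coord_mx K *m M) i j = if i \in K then M i j else 0.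
Proof.
rewrite mxE (bigD1 i) //= big1 ?addr0 => [|k ki]; rewrite mxE; last first.
  by rewrite eq_sym (negPf ki) mul0r.
by rewrite eqxx; case: (i \in K); rewrite ?mul1r ?mul0r.
Qed.

Lemma coord_mxr m K (M : 'M[F]_(m, n)) i j : (M *m coord_mx K) i j = if j \in K then M i j else 0.
Proof.
rewrite mxE (bigD1 j) //= big1 ?addr0 => [|k ki]; rewrite mxE; last first.
  by rewrite (negPf ki) mulr0.
by rewrite eqxx; case: (j \in K); rewrite ?mulr1 ?mulr0.
Qed.

(** The projection factors as [R^T *m R], where [R] selects the coordinates in [K] and
    [R *m R^T = 1], so it has the rank of [R]. *)
Lemma rank_coord_mx K : \rank (coord_mx K) = #|K|.
Proof.
pose R := rowsub (enum_val : 'I_#|K| -> 'I_n) (1%:M : 'M[F]_n).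
have RR : R *m R^T = 1%:M.
  apply/matrixP => i j; rewrite !mxE (bigD1 (enum_val i)) //= big1 => [|k ki].
    by rewrite !mxE eqxx mul1r addr0 (inj_eq enum_val_inj) eq_sym.
  by rewrite !mxE eq_sym (negPf ki) mul0r.
have rR : \rank R = #|K|.
  apply/eqP; rewrite eqn_leq rank_leq_row -[X in (X <= _)%N](mxrank1 F) -RR.
  exact: mxrankM_maxl.
have E : coord_mx K = R^T *m R.
  apply/matrixP => i j; rewrite !mxE; case: (boolP (i \in K)) => iK.
    rewrite (bigD1 (enum_rank_in iK i)) //= big1 => [|k ki].
      by rewrite !mxE enum_rankK_in // eqxx mul1r addr0 andbT.
    rewrite !mxE; case: eqP => [e|]; last by rewrite mul0r.
    by case/eqP: ki; apply: enum_val_inj; rewrite enum_rankK_in.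
  rewrite andbF big1 // => k _; rewrite !mxE; case: eqP => [e|]; last by rewrite mul0r.
  by case/negP: iK; rewrite -e enum_valP.
apply/eqP; rewrite E eqn_leq -[X in (_ <= X)%N && _]rR mxrankM_maxr /=.
by rewrite -[X in (X <= _)%N]rR -{1}[R]mul1mx -RR -mulmxA mxrankM_maxr.
Qed.

(** Split [M] into its rows in [X] and the remaining rows; the latter are supported on the columns
    in [Y]. *)
Lemma rank_zero_block M (X Y : {set 'I_n}) :
  (forall x y, M x y != 0 -> (x \in X) || (y \in Y)) ->
  (\rank M <= #|X| + #|Y|)%N.
Proof.
move=> h; have -> : M = coord_mx X *m M + coord_mx (~: X) *m M *m coord_mx Y.
  apply/matrixP => i j; rewrite mxE coord_mxr !coord_mxl inE.
  case: (boolP (i \in X)) => iX /=; first by case: ifP; rewrite addr0.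
  case: (boolP (j \in Y)) => jY; rewrite add0r //.
  by apply/eqP/(contraNT (h i j)); rewrite negb_or iX.
apply: leq_trans (mxrank_add _ _) _; rewrite -!rank_coord_mx leq_add //.
  exact: mxrankM_maxl.
exact: mxrankM_maxr.
Qed.

(** [M *m M^T] is the projection onto the cells with at least [a] successors in their block, and a
    part [p] has [p - a] of them (truncated at 0). *)
Lemma rank_jordan_nilX lam a : sumn lam = n ->
  (\sum_(p <- lam) (p - a) <= \rank (jordan_nil F n lam ^+ a))%N.
Proof.
move=> hn; pose M := jordan_nil F n lam ^+ a.
pose K := [set i : 'I_n | (a <= coff lam i)%N].
have -> : (\sum_(p <- lam) (p - a) = #|K|)%N.
  have := cell_sum_parts lam (fun _ d => (a <= d)%N : nat); rewrite hn.
  rewrite -big_mkcond /= sum1dep_card => ->; apply: eq_bigr => p _.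
  elim: p => [|p IH]; first by rewrite big_ord0.
  rewrite big_ord_recl /= subn0.
  rewrite (eq_bigr (fun e : 'I_p => (a <= p.-1 - e)%N : nat)) -?IH => [|e _]; last first.
    by rewrite /bump /=; congr (nat_of_bool (_ <= _)%N); lia.
  by case: (leqP a p) => ap; lia.
rewrite -rank_coord_mx.
suff -> : coord_mx K = M *m M^T by apply: mxrankM_maxl.
apply/matrixP => i j; rewrite !mxE inE.
have ->: \sum_k M i k * M^T k j = \sum_(k < n) ((k == i + a :> nat)%N && ((i == j) && (a <= coff lam i)%N))%:R.
  apply: eq_bigr => k _; rewrite mxE !jordan_nilXE // -natrM mulnb.
  congr (nat_of_bool _)%:R; case: (k =P i + a :> nat)%N => //= ->.
  case: (i =P j) => [->|ij]; first by rewrite eqxx andbb.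
  rewrite eqn_add2r; case: eqP => [/val_inj //|]; by rewrite andbF.
case: (boolP ((i == j) && _)) => h; last by rewrite big1 // => k _; rewrite andbF.
case/andP: h => _ ac; have ia : (i + a < n)%N.
  by have := @coff_bound lam i; rewrite hn ltn_ord => /(_ isT); apply: leq_ltn_trans; rewrite leq_add2l.
rewrite (bigD1 (Ordinal ia)) //= big1 ?addr0 => [|k ki]; first by rewrite eqxx.
case: eqP => // e; case/eqP: ki; exact: val_inj.
Qed.
End Rank.

(** * Jordan bases of nilpotent matrices *)

Section JordanBasis.
Local Open Scope ring_scope.
Variables (F : fieldType) (n : nat) (A : 'M[F]_n).

Lemma stable_exp m (X : 'M[F]_(m, n)) : (X *m A <= X)%MS ->
  forall l, (X *m A ^+ l <= X)%MS.
Proof.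
move=> XA; elim=> [|l IH]; first by rewrite expr0 mulmx1.
rewrite exprSr -mulmxE mulmxA; apply: submx_trans XA; exact: submxMr.
Qed.

Hypothesis nilA : nilpotent_mx A.

(** Induction on the rank: split off the cyclic space of a vector with the longest chain and recurse
    on a stable complement. The last clause bounds the later parts, so that the list of parts stays
    sorted. *)
Lemma jordan_basis (X : 'M[F]_n) : (X *m A <= X)%MS ->
  exists lam (w : nat -> 'rV[F]_n),
    [/\ is_partition lam, sumn lam = \rank X,
        (\matrix_(x < sumn lam) w x :=: X)%MS,
        forall x, (x < sumn lam)%N ->
          w x *m A = if (0 < coff lam x)%N then w x.+1 else 0
      & forall L, X *m A ^+ L = 0 -> all (leq^~ L) lam].
Proof.
have [r] := ubnP (\rank X); elim: r X => // r IH X Xr XA.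
have [X0|X0] := eqVneq X 0.
  exists [::], (fun _ => 0); rewrite X0; split; rewrite ?mxrank0 //.
  by apply/eqmxP; rewrite sub0mx andbT; apply/row_subP => -[].
have exL : exists L, X *m A ^+ L == 0.
  by case: nilA => L AL; exists L; rewrite AL mulmx0.
case: (ex_minnP exL) => -[|L] /eqP XL minL.
  by rewrite expr0 mulmx1 in XL; rewrite XL eqxx in X0.
have [i [j c0]] : exists i j, (X *m A ^+ L) i j != 0.
  have : X *m A ^+ L != 0 by apply/negP => /minL; rewrite ltnn.
  case/matrix0Pn => i [j ij]; by exists i, j.
pose v := row i X.
have vE l k : (v *m A ^+ l) 0 k = (X *m A ^+ l) i k by rewrite -row_mul mxE.
have vbig l : (L < l)%N -> v *m A ^+ l = 0.
  by move=> Ll; rewrite -row_mul -(subnKC Ll) exprD -mulmxE mulmxA XL mul0mx row0.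
(* The columns of [C] are the functionals taking [u] to coordinate [j] of [u A^(L - l)]. On the
   chain of [v] they form a triangular matrix with the nonzero entry [(v A^L)_j] on the diagonal, so
   their common kernel in [X] is a complement of the chain. *)
pose C : 'M[F]_(n, L.+1) := \matrix_(a, l) (A ^+ (L - l)) a j.
pose R : 'M[F]_(L.+1, n) := \matrix_(l < L.+1) (v *m A ^+ l).
have CE m (u : 'M[F]_(m, n)) a l : (u *m C) a l = (u *m A ^+ (L - l)) a j.
  by rewrite !mxE; apply: eq_bigr => k _; rewrite mxE.
have RE (M : 'M[F]_n) l k : (R *m M) l k = (v *m A ^+ l *m M) 0 k.
  have -> : v *m A ^+ l = row l R by rewrite rowK.
  by rewrite -row_mul [RHS]mxE.
have uRC : R *m C \in unitmx.
  rewrite -unitmx_tr unitmxE det_trig ?unitfE.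
    apply/prodf_neq0 => l _; rewrite mxE CE RE -mulmxA mulmxE -exprD subnKC ?vE //.
    by rewrite -ltnS.
  apply/is_trig_mxP => l l' ll'; rewrite mxE CE RE -mulmxA mulmxE -exprD vbig ?mxE //.
  have := ltn_ord l'; lia.
pose X' := (X :&: kermx C)%MS.
have X'X : (X' <= X)%MS by apply: capmxSl.
have memX' (u : 'rV_n) : (u <= X')%MS = (u <= X)%MS && (u *m C == 0).
  by rewrite sub_capmx; congr (_ && _); apply/sub_kermxP/eqP.
(* Functional [l] at [u A] is functional [l - 1] at [u]; for [l = 0] it vanishes because [A^(L + 1)]
   kills [X]. *)
have X'A : (X' *m A <= X')%MS.
  apply/row_subP => k; rewrite row_mul memX'.
  have := row_sub k X'; set u := row k X'; rewrite memX' => /andP[uX /eqP uC].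
  apply/andP; split; first by apply: submx_trans XA; apply: submxMr.
  apply/eqP/matrixP => a l; rewrite CE [RHS]mxE ord1 -mulmxA mulmxE -exprS.
  case: (posnP l) => [->|l0].
    have /submxP[D ->] := uX; by rewrite subn0 -mulmxA XL mulmx0 mxE.
  have lL : (L - l.-1 = (L - l).+1)%N by have := ltn_ord l; lia.
  have ll : (l.-1 < L.+1)%N by apply: leq_ltn_trans (leq_pred _) (ltn_ord l).
  by move/matrixP: uC => /(_ 0 (Ordinal ll)); rewrite CE /= lL => ->; rewrite mxE.
have fR : row_free R.
  rewrite /row_free eqn_leq rank_leq_row /=.
  by rewrite -{1}(mxrank_unit uRC) mxrankM_maxl.
have RX : (R <= X)%MS.
  apply/row_subP => l; rewrite rowK; apply: submx_trans (stable_exp XA l).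
  exact/submxMr/row_sub.
have RX'X : (R + X' :=: X)%MS.
  apply/eqmxP; rewrite addsmx_sub RX X'X; apply/row_subP => k.
  (* [q] is the projection of [u] onto the chain along the kernel of [C]. *)
  set u := row k X; pose q := u *m C *m invmx (R *m C) *m R.
  rewrite -[u](subrK q) addrC addmx_sub_adds //; first exact: submxMl.
  rewrite memX' mulmxBl /q -!mulmxA mulVmx // mulmx1 subrr eqxx andbT.
  rewrite addmx_sub ?eqmx_opp ?row_sub //.
  by rewrite !mulmxA; apply: submx_trans RX; apply: submxMl.
have dRX' : (R :&: X' = 0)%MS.
  apply/eqP; rewrite -submx0; apply/row_subP => k.
  have := row_sub k (R :&: X')%MS; set u := row k _; rewrite sub_capmx memX'.
  case/and3P=> /submxP[D ->] _; rewrite -mulmxA => /eqP D0.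
  by rewrite -[D](mulmxK uRC) D0 !mul0mx sub0mx.
have rX : \rank X = (L.+1 + \rank X')%N.
  by rewrite -RX'X mxrank_disjoint_sum // (eqP fR).
have rX' : (\rank X' < r)%N by rewrite -ltnS; apply: leq_trans Xr; rewrite rX addSn !ltnS leq_addl.
have [lam [w [plam slam wX' wA wL]]] := IH X' rX' X'A.
exists (L.+1 :: lam), (fun x => if (x < L.+1)%N then v *m A ^+ x else w (x - L.+1)%N).
have X'0 a : X *m A ^+ a = 0 -> X' *m A ^+ a = 0.
  by move=> Xa; case/submxP: X'X => D ->; rewrite -mulmxA Xa mulmx0.
have lamL := wL _ (X'0 _ XL).
split.
- move: plam; rewrite /is_partition /= => /andP[sl ->]; rewrite andbT.
  rewrite path_sortedE ?sl ?andbT // => a b c /= ab bc; exact: leq_trans bc ab.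
- by rewrite /= rX slam.
- apply/eqmxP/andP; split.
    apply/row_subP => k; rewrite rowK; case: ltnP => kL.
      apply: submx_trans (stable_exp XA k); exact/submxMr/row_sub.
    have kl : (k - L.+1 < sumn lam)%N by rewrite ltn_subLR //; exact: (ltn_ord k).
    apply: submx_trans X'X; rewrite -wX'.
    by apply: (eq_row_sub (Ordinal kl)); rewrite rowK.
  rewrite -RX'X addsmx_sub; apply/andP; split.
    apply/row_subP => l; rewrite rowK.
    have ls : (l < sumn (L.+1 :: lam))%N by apply: ltn_addr.
    by apply: (eq_row_sub (Ordinal ls)); rewrite rowK /= ltn_ord.
  rewrite -wX'; apply/row_subP => l; rewrite rowK.
  have ls : (L.+1 + l < sumn (L.+1 :: lam))%N by rewrite ltn_add2l.
  by apply: (eq_row_sub (Ordinal ls)); rewrite rowK /= ltnNge leq_addr addKn.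
- move=> x /= xs; case: (ltnP x L.+1) => xL.
    rewrite -mulmxA mulmxE -exprSr subn_gt0; case: ltnP => h; first by rewrite ltnS h.
    by rewrite vbig.
  have -> : (x.+1 < L.+1)%N = false by apply/negbTE; rewrite -leqNgt ltnW.
  by rewrite subSn ?wA // ltn_subLR.
- move=> a Xa /=; rewrite minL ?Xa //=; exact/wL/X'0.
Qed.

End JordanBasis.

Section JordanForm.
Local Open Scope ring_scope.

(** A Jordan basis of the whole space, taken as the rows of [P], satisfies [P A = J P]. *)
Lemma has_shape_exists (F : fieldType) n (A : 'M[F]_n) :
  nilpotent_mx A -> exists lam, has_shape A lam.
Proof.
move=> nA; have [|lam [w [plam slam wX wA _]]] := jordan_basis nA (X := 1%:M); first exact: submx1.
rewrite mxrank1 in slam; exists lam; split=> //; split=> //.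
move: w wX wA; rewrite slam => w wX wA.
pose P := \matrix_(x < n) w x; exists P.
have uP : P \in unitmx by rewrite -row_full_unit /row_full wX mxrank1.
split=> //; suff e : P *m A = jordan_nil F n lam *m P by rewrite -mulmxA -e mulKmx.
apply/row_matrixP => x; rewrite row_mul rowK wA //.
apply/rowP => y; rewrite !mxE.
have [c0|c0] := posnP (coff lam x).
  by rewrite mxE big1 // => z _; rewrite jordan_nilE // c0 andbF mul0r.
have [x' Ex _] := next_cell slam c0.
rewrite (bigD1 x') //= jordan_nilE // Ex eqxx c0 mul1r big1 ?addr0 => [|z zx].
  by rewrite mxE Ex.
by rewrite jordan_nilE //; case: eqP => [e|]; [case/eqP: zx; apply: val_inj; rewrite /= Ex e|rewrite mul0r].
Qed.

End JordanForm.

(** * Triangularisation compatible with a colouring *)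

Lemma index_enum_ord n (K : {set 'I_n}) (i j : 'I_n) : i \in K -> j \in K ->
  (index i (enum K) < index j (enum K))%N -> (i < j)%N.
Proof.
move=> iK jK; apply: (@sorted_ltn_index _ (fun i j : 'I_n => (i < j)%N)).
- by move=> a b c; apply: ltn_trans.
- rewrite /enum_mem; apply: sorted_filter; first by move=> a b c; apply: ltn_trans.
  rewrite -enumT; have := iota_ltn_sorted 0 n; rewrite -val_enum_ord sorted_map; exact: sub_sorted.
- by rewrite mem_enum.
- by rewrite mem_enum.
Qed.

Section Triangular.
Local Open Scope ring_scope.
Variables (F : fieldType) (n : nat) (A : 'M[F]_n) (T : finType).
Variables (col : 'I_n -> T) (le : rel T).
Hypotheses (le_refl : reflexive le) (le_anti : antisymmetric le) (le_trans : transitive le).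
Hypothesis A_le : forall x y, A x y != 0 -> le (col x) (col y).
Hypothesis nilA : nilpotent_mx A.

Let N : 'M[F]_n := \matrix_(x, y) if col x == col y then A x y else 0.
Let K v := [set x | col x == v].

Let expA_le L x y : (A ^+ L) x y != 0 -> le (col x) (col y).
Proof.
elim: L x => [|L IH] x; first by rewrite expr0 mxE; case: (x =P y) => [->|]; rewrite ?eqxx.
rewrite exprS mxE => /eqP h.
have [z /andP[zx zy]] : exists z, (A x z != 0) && ((A ^+ L) z y != 0).
  apply/existsP; apply: contra_notT h => /existsPn h.
  rewrite big1 // => z _; apply/eqP; rewrite mulf_eq0.
  by have := h z; rewrite negb_and !negbK.
exact: le_trans (A_le zx) (IH _ zy).
Qed.

(** A walk along nonzero entries of [A] between two cells of one colour cannot leave that colour, by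
    antisymmetry. So powers of the block diagonal part [N] are block diagonal parts of powers of
    [A]. *)
Let expN L x y : (N ^+ L) x y = if col x == col y then (A ^+ L) x y else 0.
Proof.
elim: L x => [|L IH] x.
  by rewrite !expr0 mxE; case: (x =P y) => [->|]; rewrite ?eqxx ?if_same.
rewrite !exprS !mxE; case: eqP => [xy|/eqP xy]; last first.
  rewrite big1 // => z _; rewrite mxE IH; case: eqP => [<-|_]; last by rewrite mul0r.
  by rewrite (negPf xy) mulr0.
apply: eq_bigr => z _; rewrite mxE IH -xy [col z == _]eq_sym.
case: eqP => [//|xz]; rewrite mulr0; apply/esym/eqP; apply/contra_notT: xz.
rewrite mulf_eq0 negb_or => /andP[/A_le h1 /expA_le h2]; apply: le_anti.
by rewrite h1 xy.
Qed.

Let nilN : nilpotent_mx N.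
Proof. by case: nilA => L AL; exists L; apply/matrixP => x y; rewrite expN AL !mxE if_same. Qed.

(* P is assembled from Jordan bases of the diagonal blocks of the colour classes. *)
Lemma nilpotent_triangular : exists2 P : 'M[F]_n, P \in unitmx &
  forall x y, (P *m A *m invmx P) x y != 0 ->
    le (col x) (col y) /\ (col x = col y -> (x < y)%N).
Proof.
pose E v : 'M[F]_n := coord_mx F (K v).
have EN v : E v *m N = N *m E v.
  apply/matrixP => x y; rewrite coord_mxl coord_mxr !inE mxE.
  by case: (col x =P col y) => [->//|]; rewrite !if_same.
have /fin_all_exists[f hf] v : exists p : seq nat * (nat -> 'rV[F]_n),
    [/\ sumn p.1 = #|K v|, (\matrix_(x < sumn p.1) p.2 x :=: E v)%MS &
        forall x, (x < sumn p.1)%N ->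
          p.2 x *m N = if (0 < coff p.1 x)%N then p.2 x.+1 else 0].
  have [|lam [w [_ s h1 h2 _]]] := jordan_basis nilN (X := E v); first by rewrite EN submxMl.
  by exists (lam, w); rewrite /= s rank_coord_mx; split=> //; rewrite -(rank_coord_mx F) -s.
pose lam v := (f v).1; pose w v := (f v).2.
have slam v : sumn (lam v) = #|K v| by case: (hf v).
have wE v l : (l < #|K v|)%N -> (w v l <= E v)%MS.
  case: (hf v) => s h _; rewrite -s => lt; rewrite -h.
  by apply: (eq_row_sub (Ordinal lt)); rewrite rowK.
have wN v l : (l < #|K v|)%N ->
    w v l *m N = if (0 < coff (lam v) l)%N then w v l.+1 else 0.
  by rewrite -slam => lt; case: (hf v) => _ _ ->.
pose idx x := index x (enum (K (col x))).
have xK x : x \in K (col x) by rewrite inE.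
have idxK x : (idx x < #|K (col x)|)%N by rewrite cardE index_mem mem_enum.
have idx_ex v l : (l < #|K v|)%N -> exists2 x, col x = v & idx x = l.
  move=> lv; have x0 : 'I_n by case: (pickP (mem (K v))) => [x //|/eq_card0 e]; move: lv; rewrite e.
  exists (nth x0 (enum (K v)) l); first have := mem_nth x0 (s := enum (K v)) (n := l).
    by rewrite -cardE lv mem_enum inE => /(_ isT)/eqP.
  have e : col (nth x0 (enum (K v)) l) = v.
    by have := mem_nth x0 (s := enum (K v)) (n := l); rewrite -cardE lv mem_enum inE => /(_ isT)/eqP.
  by rewrite /idx e index_uniq ?enum_uniq // -cardE.
pose P := \matrix_x w (col x) (idx x).
have uP : P \in unitmx.
  rewrite -row_full_unit -sub1mx; apply/row_subP => x; rewrite row1.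
  apply: (@submx_trans _ _ _ _ _ _ (E (col x))).
    by apply: (eq_row_sub x); apply/rowP => y; rewrite !mxE eqxx inE eqxx andbT eq_sym.
  case: (hf (col x)) => s <- _; apply/row_subP => l; rewrite rowK.
  have [|y yx yl] := idx_ex (col x) l; first by rewrite -s.
  by apply: (eq_row_sub y); rewrite rowK yx yl.
(* [P] commutes with the projections onto the colour classes, so [P] and its inverse are block
   diagonal. *)
have PE v : P *m E v = E v *m P.
  apply/matrixP => x y; rewrite coord_mxl coord_mxr !inE.
  case: (boolP (col x == col y)) => [/eqP->//|xy].
  suff -> : P x y = 0 by rewrite !if_same.
  have /submxP[D] := wE _ _ (idxK x); move/rowP/(_ y); rewrite -/(idx x).
  by rewrite coord_mxr inE eq_sym (negPf xy) mxE.
have VE v : invmx P *m E v = E v *m invmx P.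
  by rewrite -[LHS](mulmxK uP) -[_ *m P]mulmxA -PE mulKmx.
have VE0 x y : col x != col y -> invmx P x y = 0.
  move=> xy; have /matrixP/(_ x y) := VE (col y).
  by rewrite coord_mxl coord_mxr !inE eqxx (negPf xy).
have P0 x y : col x != col y -> P x y = 0.
  move=> xy; have /matrixP/(_ x y) := PE (col y).
  by rewrite coord_mxl coord_mxr !inE eqxx (negPf xy).
(* In the new basis [N] becomes the Jordan step from a position of a class to the next one. *)
pose S : 'M[F]_n := \matrix_(x, y)
  ([&& col y == col x, idx y == (idx x).+1 & 0 < coff (lam (col x)) (idx x)]%N)%:R.
have PN : P *m N = S *m P.
  apply/row_matrixP => x; rewrite !row_mul rowK wN // mulmx_sum_row.
  have [c0|c0] := posnP (coff (lam (col x)) (idx x)).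
    by rewrite big1 // => z _; rewrite !mxE c0 !andbF scale0r.
  have [|y yx yl] := idx_ex (col x) (idx x).+1.
    have := coff_bound (lam := lam (col x)) (i := idx x); rewrite slam idxK => /(_ isT).
    by apply: leq_ltn_trans; rewrite -addn1 leq_add2l.
  rewrite (bigD1 y) //= big1 ?addr0 => [|z zy].
    by rewrite !mxE yx yl !eqxx c0 scale1r rowK yx yl.
  rewrite !mxE; case: (col z =P col x) => [zx|_]; last by rewrite scale0r.
  case: (idx z =P (idx x).+1) => [zl|_]; last by rewrite scale0r.
  case/eqP: zy; rewrite -[z](nth_index z (s := enum (K (col z)))) ?mem_enum //.
  rewrite -[y in RHS](nth_index z (s := enum (K (col y)))) ?mem_enum //.
  by rewrite -!/(idx _) yx zx yl zl.
exists P => // x y h.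
(* [P] and its inverse keep colours, so a nonzero entry of the conjugate comes from a nonzero entry
   of [A] between the same two colours. *)
have [a [b [xa ab bY]]] : exists a b, [/\ col x = col a, A a b != 0 & col b = col y].
  move: h; rewrite mxE => /eqP h.
  have [b /andP[h1 h2]] : exists b, ((P *m A) x b != 0) && (invmx P b y != 0).
    apply/existsP; apply: contra_notT h => /existsPn h.
    rewrite big1 // => z _; apply/eqP; rewrite mulf_eq0.
    by have := h z; rewrite negb_and !negbK.
  move: h1; rewrite mxE => /eqP h1.
  have [a /andP[h3 h4]] : exists a, (P x a != 0) && (A a b != 0).
    apply/existsP; apply: contra_notT h1 => /existsPn h1.
    rewrite big1 // => z _; apply/eqP; rewrite mulf_eq0.
    by have := h1 z; rewrite negb_and !negbK.
  exists a, b; split=> //; apply/eqP; first by apply: contraNT h3 => /P0/eqP.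
  by apply: contraNT h2 => /VE0/eqP.
split; first by rewrite xa -bY A_le.
(* Inside one colour only [N] contributes. Its conjugate is [S], whose nonzero entries lead to the
   next, hence larger, index of the class. *)
move=> xy; move: h; have -> : (P *m A *m invmx P) x y = (P *m N *m invmx P) x y.
  rewrite -!mulmxA !mxE; apply: eq_bigr => a' _.
  have [xa'|/P0->] := eqVneq (col x) (col a'); last by rewrite !mul0r.
  congr (_ * _); rewrite !mxE; apply: eq_bigr => b' _; rewrite mxE.
  have [by'|/VE0->] := eqVneq (col b') (col y); last by rewrite !mulr0.
  by rewrite -xa' xy by' eqxx.
rewrite PN mulmxK // mxE; case: and3P => [[/eqP yx /eqP yl _] _|]; last by rewrite eqxx.
apply: (@index_enum_ord _ (K (col x))); rewrite ?inE ?yx //.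
by rewrite -{2}yx -!/(idx _) yl.
Qed.

End Triangular.

(** * Ranks of powers in the nilpotent commutator *)

(* The strict order on the cells; cells with equal off and coff are ordered by index. *)
Definition cell_lt (lam : seq nat) (x y : nat) : bool :=
  [&& off lam x <= off lam y, coff lam y <= coff lam x &
      (off lam y <= off lam x) && (coff lam x <= coff lam y) ==> (x < y)].

Section Centralizer.
Local Open Scope ring_scope.

Lemma conj_mxX (F : fieldType) n (P A : 'M[F]_n) a : P \in unitmx ->
  (P *m A *m invmx P) ^+ a = P *m A ^+ a *m invmx P.
Proof.
move=> uP; elim: a => [|a IH]; first by rewrite !expr0 mulmx1 mulmxV.
by rewrite !exprS IH -!mulmxE !mulmxA mulmxKV.
Qed.

Lemma rank_conj_mx (F : fieldType) n (P A : 'M[F]_n) : P \in unitmx ->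
  \rank (P *m A *m invmx P) = \rank A.
Proof.
move=> uP; rewrite mxrankMfree ?row_free_unit ?unitmx_inv //.
by rewrite eqmxMfull // row_full_unit.
Qed.

(** Colour each cell by the pair ([off], [coff]). Monotonicity along nonzero entries is then the
    hypothesis of the triangularisation; [inord] only serves to make the colours a finite type. *)
Lemma comm_jordan_nil_triangular (F : fieldType) n lam (A : 'M[F]_n) :
  sumn lam = n -> nilpotent_mx A -> A *m jordan_nil F n lam = jordan_nil F n lam *m A ->
  exists2 P : 'M[F]_n, P \in unitmx &
    forall x y, (P *m A *m invmx P) x y != 0 -> cell_lt lam x y.
Proof.
move=> hn nA com.
pose col (x : 'I_n) : 'I_n.+1 * 'I_n.+1 := (inord (off lam x), inord (coff lam x)).
pose le (p q : 'I_n.+1 * 'I_n.+1) := (p.1 <= q.1)%N && (q.2 <= p.2)%N.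
have leE (x y : 'I_n) : le (col x) (col y) = (off lam x <= off lam y)%N && (coff lam y <= coff lam x)%N.
  have h (z : 'I_n) : (off lam z <= n)%N && (coff lam z <= n)%N; last first.
    by rewrite /le /= !inordK ?ltnS //; case/andP: (h x); case/andP: (h y).
  have := @coff_bound lam z; rewrite hn ltn_ord => /(_ isT); have := off_le lam z.
  have := ltn_ord z; lia.
have [||||P uP h] := @nilpotent_triangular F n A _ col le _ _ _ _ nA.
- by move=> p; rewrite /le !leqnn.
- move=> [p1 p2] [q1 q2]; rewrite /le /= => h; congr (_, _); apply: val_inj => /=; lia.
- by move=> [p1 p2] [q1 q2] [r1 r2]; rewrite /le /=; lia.
- by move=> x y /(comm_jordan_nil_entry hn com); rewrite leE.
exists P => // x y /h[]; rewrite leE => /andP[h1 h2] h3.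
rewrite /cell_lt h1 h2 /=; apply/implyP => h4; apply: h3.
by rewrite /col; congr (inord _, inord _); lia.
Qed.

(** Each factor raises the level by at least 1, so a nonzero entry of the power whose row has level
    at least [a] has a column of level at least [b]. *)
Lemma strict_level_rank (F : fieldType) n (A : 'M[F]_n) (tau : 'I_n -> nat) (a b : nat) :
  (forall x y, A x y != 0 -> (tau x < tau y)%N) -> (a <= b)%N ->
  (\rank (A ^+ (b - a)) <= #|[set x | tau x < a]%N| + #|[set x | b <= tau x]%N|)%N.
Proof.
move=> h ab; apply: rank_zero_block => x y; rewrite !inE => xy.
suff : (tau x + (b - a) <= tau y)%N by lia.
elim: (b - a)%N x xy => [|c IH] x.
  by rewrite expr0 mxE addn0; case: (x =P y) => [->//|_]; rewrite eqxx.
rewrite exprS mxE => /eqP xy.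
have [z /andP[/h xz /IH zy]] : exists z, (A x z != 0) && ((A ^+ c) z y != 0).
  apply/existsP; apply: contra_notT xy => /existsPn h'.
  rewrite big1 // => z _; apply/eqP; rewrite mulf_eq0.
  by have := h' z; rewrite negb_and !negbK.
lia.
Qed.

End Centralizer.

(* The partition r(m,t) of the paper. *)
Definition ar (m t : nat) : seq nat :=
  nseq (m %% t) (m %/ t).+1 ++ nseq (t - m %% t) (m %/ t).

Definition stair (mu k : nat) : seq nat := [seq mu - 2 * i | i <- iota 0 k].

Lemma sumn_ar m t : 0 < t -> sumn (ar m t) = m.
Proof.
move=> t0; rewrite sumn_cat !sumn_nseq; have := divn_eq m t.
have : m %% t < t by rewrite ltn_mod.
move: (m %/ t) (m %% t) => q s st ->; nia.
Qed.

Lemma size_ar m t : 0 < t -> size (ar m t) = t.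
Proof. by move=> t0; rewrite size_cat !size_nseq subnKC // ltnW // ltn_mod. Qed.

Lemma nth_ar m t i : i < t -> nth 0 (ar m t) i = m %/ t + (i < m %% t).
Proof.
move=> it; rewrite nth_cat size_nseq !nth_nseq.
case: ltnP => h; first by rewrite addn1.
by rewrite addn0 ltn_sub2r // (leq_ltn_trans h it).
Qed.

Lemma size_stair mu k : size (stair mu k) = k.
Proof. by rewrite size_map size_iota. Qed.

Lemma nth_stair mu k i : i < k -> nth 0 (stair mu k) i = mu - 2 * i.
Proof. by move=> ik; rewrite (nth_map 0) ?size_iota // nth_iota. Qed.

(** The hypothesis keeps the last entry [mu - 2 * k.-1] from being truncated. *)
Lemma sumn_stair mu k : 2 * k <= mu.+1 -> sumn (stair mu k) = k * (mu - k.-1).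
Proof.
elim: k => // j IH jk; rewrite /stair -[j.+1]addn1 iotaD map_cat sumn_cat -/(stair mu j).
by rewrite IH ?addn1 /=; case: j jk {IH}; nia.
Qed.

(** * Levels for a staircase followed by an almost rectangular partition *)

Section Level.
Variables (mu k t : nat).
Hypotheses (hk : 2 * k < mu) (ht : 0 < t <= mu - 2 * k).
Let m := mu - 2 * k.
Let lam := stair mu k ++ ar m t.

Lemma stair_cell x : x < sumn lam -> blk lam x < k ->
  (off lam x + coff lam x).+1 = mu - 2 * blk lam x.
Proof.
move=> xs xk; have [-> _] := cell_size xs.
by rewrite nth_cat size_stair xk nth_stair.
Qed.

Lemma ar_cell x : x < sumn lam -> k <= blk lam x ->
  blk lam x - k < t /\
  (off lam x + coff lam x).+1 = m %/ t + (blk lam x - k < m %% t).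
Proof.
move=> xs xk; have [-> ] := cell_size xs; rewrite size_cat size_stair size_ar; last by case/andP: ht.
move=> h.
have h' : blk lam x - k < t by lia.
by rewrite nth_cat size_stair (ltnNge (blk lam x) k) xk /= nth_ar.
Qed.

(* The cells of the almost rectangular part are numbered k, .., mu - k - 1 row by row,
   in the order in which they form a single Jordan chain of length mu - 2k. *)
Definition level x :=
  if blk lam x < k then off lam x + blk lam x else k + (t * off lam x + (blk lam x - k)).

(** Row [c] of the almost rectangular part is the residue class of [c] modulo [t] in [0, .., m - 1]:
    a step along the row adds [t], and a row ends when adding [t] would leave this range. *)
Lemma ar_level x : x < sumn lam -> k <= blk lam x ->
  t * off lam x + (blk lam x - k) + coff lam x < m /\
  (coff lam x = 0 -> m <= t * off lam x + (blk lam x - k) + t).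
Proof.
move=> xs xk; have [] := ar_cell xs xk.
have q0 : 0 < m %/ t by rewrite divn_gt0; case/andP: ht.
have := divn_eq m t; have : m %% t < t by rewrite ltn_mod; case/andP: ht.
move: (blk _ _ - k) (off _ _) (coff _ _) (m %/ t) (m %% t) q0 => c e d q s q0 st -> ct h.
split; last by move=> d0; case: ltnP h; nia.
case: ltnP h => h ed; nia.
Qed.

(** On the first [k] parts twice the level is [mu - 1 + off - coff], which strictly grows unless
    both distances agree, and then the cells coincide. In the mixed cases the bounds on [off] or
    [coff] suffice. Inside the almost rectangular part [off] decides first; for equal [off], a
    strictly later cell lies in a later row. *)
Lemma level_lt x y : x < sumn lam -> y < sumn lam -> cell_lt lam x y -> level x < level y.
Proof.
move=> xs ys /and3P[h1 h2 h3]; rewrite /level.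
have t0 : 0 < t by case/andP: ht.
have xE := cell_index xs; have yE := cell_index ys.
case: (ltnP (blk lam x) k) => xk; case: (ltnP (blk lam y) k) => yk.
- have := stair_cell xs xk; have := stair_cell ys yk => e1 e2.
  have h : blk lam x = blk lam y -> off lam x = off lam y -> x = y.
    by move=> e3 e4; rewrite xE yE e3 e4.
  lia.
- have : off lam y <= t * off lam y by rewrite leq_pmull.
  lia.
- have [] := ar_level xs xk; have := stair_cell ys yk; rewrite /m; lia.
have [ct es] := ar_cell xs xk; have [ct' es'] := ar_cell ys yk.
rewrite ltn_add2l; case: (ltnP (off lam x) (off lam y)) => e.
  have : t * (off lam x).+1 <= t * off lam y by rewrite leq_mul2l e orbT.
  rewrite mulnS; lia.
have {h1 e} e : off lam x = off lam y by lia.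
rewrite -e ltn_add2l; case: (ltnP (blk lam x - k)) => // hb.
have hb' : blk lam y <= blk lam x by lia.
have hs : (blk lam x - k < m %% t) <= (blk lam y - k < m %% t).
  by case: (ltnP (blk lam x - k)) => // h; rewrite (leq_ltn_trans _ h) // leq_sub2r.
have ex : x < y by apply: (implyP h3); lia.
have := blk_mono (ltnW ex) ys => h4.
have e' : blk lam x = blk lam y by lia.
by move: ex; rewrite xE yE e' e ltnn.
Qed.

Lemma count_corner (f : nat -> nat -> nat) i :
  (forall b, b < k -> \sum_(e < mu - 2 * b) f b e <= i - b) -> i <= k ->
  (\sum_(b < k) \sum_(e < mu - 2 * b) f b e) * 2 <= i * i.+1.
Proof.
move=> hf ik; have : \sum_(b < k) \sum_(e < mu - 2 * b) f b e <= \sum_(b < k) (i - b).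
  by apply: leq_sum => b _; apply: hf.
suff : (\sum_(b < k) (i - b)) * 2 = i * i.+1 by lia.
rewrite -(subnKC ik) big_split_ord /= [X in _ + X]big1 => [|b _]; last lia.
rewrite addn0; elim: (i) => [|j IH]; first by rewrite big_ord0.
by rewrite big_ord_recl subn0 mulnDl (eq_bigr (fun b : 'I_j => j - b)) // IH; nia.
Qed.

Lemma sum_lt p a : \sum_(e < p) ((e < a) : nat) <= a.
Proof.
elim: p => [|p IH]; first by rewrite big_ord0.
have [pa|pa] := leqP p.+1 a; last first.
  by rewrite big_ord_recr /= (_ : (p < a) = false) ?addn0 //; lia.
apply: leq_trans pa; rewrite -[X in _ <= X]card_ord -sum1_card.
by apply: leq_sum => e _; case: (_ < _).
Qed.

(** The almost rectangular part occupies levels [k] to [mu - k - 1] only, so it is avoided when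
    [i <= k]. Part [b] of the staircase has at most [i - b] cells at each end, and each of the two
    corners has at most [i (i + 1) / 2] cells. *)
Lemma card_level i : i <= k -> 
  #|[set x : 'I_(sumn lam) | level x < i]| + #|[set x : 'I_(sumn lam) | mu - i <= level x]|
  <= i * i.+1.
Proof.
move=> ik.
have cnt (P : pred 'I_(sumn lam)) (f : nat -> nat -> nat -> nat) :
   (forall x, P x -> blk lam x < k /\ f (blk lam x) (off lam x) (coff lam x) = 1) ->
   #|[set x | P x]| <= \sum_(b < k) \sum_(e < mu - 2 * b) f b e ((mu - 2 * b).-1 - e).
  move=> hP; pose g b e d := if b < k then f b e d else 0.
  apply: (@leq_trans (\sum_(x < sumn lam) g (blk lam x) (off lam x) (coff lam x))).
    rewrite -sum1dep_card big_mkcond /=; apply: leq_sum => x _.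
    by case: ifP => // /hP[h1 h2]; rewrite /g h1 h2.
  rewrite cell_sum size_cat size_stair big_split_ord /= [X in _ + X]big1 => [|b _]; last first.
    by rewrite big1 // => e _; rewrite /g ltnNge leq_addr.
  rewrite addn0; apply: leq_sum => b _; rewrite nth_cat size_stair ltn_ord nth_stair //.
  by apply: leq_sum => e _; rewrite /g ltn_ord.
have h1 : #|[set x : 'I_(sumn lam) | level x < i]| * 2 <= i * i.+1.
  apply: leq_trans (count_corner (f := fun b e => (e < i - b) : nat) _ ik); last first.
    by move=> b _; apply: sum_lt.
  rewrite leq_mul2r /=; apply: (cnt _ (fun b e d => (e < i - b) : nat)) => x.
  rewrite /level; case: (ltnP (blk lam x) k) => xk h; last lia.
  by split=> //; rewrite (_ : off lam x < i - blk lam x) //; lia.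
have h2 : #|[set x : 'I_(sumn lam) | mu - i <= level x]| * 2 <= i * i.+1.
  apply: leq_trans (count_corner (f := fun b e => ((mu - 2 * b).-1 - e < i - b) : nat) _ ik); last first.
    move=> b _; rewrite (reindex_inj rev_ord_inj) /=.
    apply: leq_trans (sum_lt (mu - 2 * b) (i - b)); apply: leq_sum => e _.
    by rewrite (_ : _.-1 - (_ - _.+1) = e) //; have := ltn_ord e; lia.
  rewrite leq_mul2r /=; apply: (cnt _ (fun b e d => (d < i - b) : nat)) => x.
  rewrite /level; case: (ltnP (blk lam x) k) => xk h.
    have := stair_cell (ltn_ord x) xk => e.
    by split=> //; rewrite (_ : coff lam x < i - blk lam x) //; lia.
  have [] := ar_level (ltn_ord x) xk; rewrite /m; lia.
lia.
Qed.

Local Open Scope ring_scope.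

(** The exponent is the distance from level [i] to level [mu - i]. *)
Lemma centralizer_rank (F : fieldType) (A : 'M[F]_(sumn lam)) i :
  nilpotent_mx A -> A *m jordan_nil F _ lam = jordan_nil F _ lam *m A -> (i <= k)%N ->
  (\rank (A ^+ (mu - 2 * i)) <= i * i.+1)%N.
Proof.
move=> nA com ik; have [P uP hP] := comm_jordan_nil_triangular erefl nA com.
rewrite -(rank_conj_mx _ uP) -conj_mxX //.
apply: leq_trans (card_level ik).
have -> : (mu - 2 * i = mu - i - i)%N by lia.
apply: (@strict_level_rank _ _ _ (fun x => level x)); last lia.
move=> x y /hP; exact: level_lt.
Qed.

End Level.

(** * Partitions whose image is the staircase *)

Section Similarity.
Local Open Scope ring_scope.
Variables (F : fieldType) (n : nat).
Implicit Types A B P : 'M[F]_n.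

Lemma nilpotent_conj P A : P \in unitmx -> nilpotent_mx A ->
  nilpotent_mx (P *m A *m invmx P).
Proof. by move=> uP [a Aa]; exists a; rewrite conj_mxX // Aa mulmx0 mul0mx. Qed.

Lemma comm_conj P A B : P \in unitmx -> A *m B = B *m A ->
  (P *m A *m invmx P) *m (P *m B *m invmx P) = (P *m B *m invmx P) *m (P *m A *m invmx P).
Proof.
move=> uP AB; rewrite !mulmxA !(mulmxKV uP).
by rewrite -(mulmxA P A B) -(mulmxA P B A) AB.
Qed.

Lemma has_shape_conj P A lam : P \in unitmx -> has_shape A lam ->
  has_shape (P *m A *m invmx P) lam.
Proof.
move=> uP [h1 [h2 [Q [uQ ->]]]]; split=> //; split=> //.
exists (Q *m invmx P); rewrite unitmx_mul uQ unitmx_inv uP; split=> //.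
have -> : invmx (Q *m invmx P) = P *m invmx Q.
  have u : Q *m invmx P \in unitmx by rewrite unitmx_mul uQ unitmx_inv.
  by rewrite -[RHS](mulKmx u) !mulmxA mulmxKV // -mulmxA mulmxV // mulmx1.
by rewrite !mulmxA.
Qed.

Lemma rank_expmx_shape A lam a : has_shape A lam ->
  \rank (A ^+ a) = \rank (jordan_nil F n lam ^+ a).
Proof.
case=> _ [_ [P [uP ->]]]; have uV : invmx P \in unitmx by rewrite unitmx_inv.
by rewrite -{2}[P]invmxK conj_mxX // rank_conj_mx.
Qed.

(** Each part satisfies [p <= a + (p - a)], and the excesses [p - a] over all parts add up to at
    most the rank of [A ^+ a]. *)
Lemma take_shape_rank A lam l a : has_shape A lam ->
  (sumn (take l lam) <= l * a + \rank (A ^+ a))%N.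
Proof.
move=> sA; have [_ [hn _]] := sA; rewrite (rank_expmx_shape _ sA).
apply: leq_trans (leq_add (leqnn _) (rank_jordan_nilX F a hn)).
elim: lam l {sA hn} => [|p lam IH] [|l] //=.
by rewrite big_cons mulSn; have := IH l; lia.
Qed.

End Similarity.

Lemma nilpotent_jordan_nil (F : fieldType) n lam : sumn lam = n ->
  nilpotent_mx (jordan_nil F n lam).
Proof.
move=> hn; exists n; apply/matrixP => i j; rewrite jordan_nilXE // mxE.
by rewrite (_ : (j == i + n :> nat) = false) //; apply/eqP; have := ltn_ord j; lia.
Qed.

(** * The image of a staircase extended by an almost rectangular partition *)

Section StairPreimage.
Variables (mu k t : nat).
Hypotheses (hk : 2 * k < mu) (ht : 0 < t <= mu - 2 * k).
Let m := mu - 2 * k.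
Let lam := stair mu k ++ ar m t.

Lemma stairS : stair mu k.+1 = rcons (stair mu k) m.
Proof. by rewrite /stair -[k.+1]addn1 iotaD map_cat cats1. Qed.

Lemma sumn_lam : sumn lam = sumn (stair mu k.+1).
Proof.
rewrite stairS -cats1 /lam 2!(sumn_cat (stair mu k)) sumn_ar /= ?addn0 //; by case/andP: ht.
Qed.

Lemma is_partition_lam : is_partition lam.
Proof.
have E i : i < k + t -> nth 0 lam i = if i < k then mu - 2 * i else m %/ t + (i - k < m %% t).
  move=> it; rewrite nth_cat size_stair; case: (ltnP i k) => ik; first by rewrite nth_stair.
  by rewrite nth_ar //; lia.
have q0 : 0 < m %/ t by rewrite divn_gt0; case/andP: ht.
have qm : m %/ t <= m by apply: leq_div.
apply/andP; split; last first.
  apply/(all_nthP 0) => i; rewrite size_cat size_stair size_ar; last by case/andP: ht.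
  move=> il.
  by rewrite E //; case: (ltnP i k); lia.
apply/(sortedP 0) => i; rewrite size_cat size_stair size_ar; last by case/andP: ht.
move=> il; rewrite /geq /= !E //; last lia.
by case: (ltnP i.+1 k); case: (ltnP i k); rewrite /m in qm *; lia.
Qed.

Lemma is_partition_stairS : is_partition (stair mu k.+1).
Proof.
apply/andP; split; last first.
  by apply/(all_nthP 0) => i; rewrite size_stair => il; rewrite nth_stair; lia.
apply/(sortedP 0) => i; rewrite size_stair => il.
by rewrite !nth_stair /geq /=; lia.
Qed.

(** For [l <= k.+1] use the exponent [mu - 2 * (l - 1)]: the bound
    [l * (mu - 2 * (l - 1)) + (l - 1) * l] equals [l * (mu - (l - 1))], the sum of the first [l]
    entries of the staircase. *)
Lemma centralizer_dominated (F : fieldType) (A : 'M[F]_(sumn lam)) nu :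
  nilpotent_mx A -> (A *m jordan_nil F _ lam = jordan_nil F _ lam *m A)%R ->
  has_shape A nu -> dominated nu (stair mu k.+1).
Proof.
move=> nA com sA l; have [_ [hn _]] := sA.
case: (posnP l) => [->|l0]; first by rewrite !take0.
case: (leqP l k.+1) => lk; last first.
  rewrite (take_oversize (s := stair _ _)) ?size_stair ?(ltnW lk) // -sumn_lam -hn.
  by rewrite -{2}(cat_take_drop l nu) sumn_cat leq_addr.
apply: leq_trans (take_shape_rank l (mu - 2 * l.-1) sA) _.
rewrite /stair -map_take take_iota (minn_idPl lk) -/(stair mu l).
have := centralizer_rank hk ht nA com (i := l.-1); move=> /(_ _)/leq_trans h.
rewrite (leq_trans (leq_add (leqnn _) (h _ _ (leqnn _)))) //; first lia.
rewrite sumn_stair; last lia.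
case: l l0 lk {h} => // l _; nia.
Qed.

Let n1 := sumn (stair mu k).
(** [rho] numbers the cells of [ar m t] as one chain in which the Jordan step of [lam] adds [t]. [g]
    sends this chain to the last part [m] of the staircase and fixes the cells of the first [k]
    parts. *)
Let rho x := t * off lam x + (blk lam x - k).
Let g x := if blk lam x < k then x else n1 + rho x.

Let blk_lt x : x < sumn lam -> (blk lam x < k) = (x < n1).
Proof.
move=> xs; have [h1 h2] := cell_cat xs; case: (ltnP x n1) => h.
  have [-> _ _] := h1 h; have [_ ] := cell_size h; by rewrite size_stair.
have [-> _ _] := h2 h; by rewrite size_stair; lia.
Qed.

Let sumnE : sumn lam = n1 + m.
Proof. by rewrite /lam sumn_cat sumn_ar //; case/andP: ht. Qed.

Let rho_lt x : x < sumn lam -> k <= blk lam x -> rho x + coff lam x < m.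
Proof. by move=> xs xk; case: (ar_level hk ht xs xk). Qed.

Let g_lt (x : 'I_(sumn lam)) : g x < sumn lam.
Proof.
rewrite /g; case: (ltnP (blk lam x) k) => // xk; rewrite [X in _ < X]sumnE ltn_add2l.
by have := rho_lt (ltn_ord x) xk; lia.
Qed.

Let rho_inj x y : x < sumn lam -> y < sumn lam -> k <= blk lam x -> k <= blk lam y ->
  rho x = rho y -> x = y.
Proof.
move=> xs ys xk yk; have [cx _] := ar_cell hk ht xs xk; have [cy _] := ar_cell hk ht ys yk.
rewrite /rho ![t * _]mulnC => e.
have t0 : 0 < t by case/andP: ht.
have eo : off lam x = off lam y.
  have := congr1 (divn^~ t) e.
  by rewrite /= !divnMDl // (divn_small cx) (divn_small cy) !addn0.
rewrite (cell_index xs) (cell_index ys) eo.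
have -> : blk lam x = blk lam y by move: e; rewrite eo; lia.
by [].
Qed.

Let gf (x : 'I_(sumn lam)) := Ordinal (g_lt x).

Let gf_inj : injective gf.
Proof.
move=> x y /(congr1 val) /=; rewrite /g.
case: (ltnP (blk lam x)) => xk; case: (ltnP (blk lam y)) => yk e; apply: val_inj => //=.
- by move: xk; rewrite blk_lt // e; lia.
- by move: yk; rewrite blk_lt // -e; lia.
by apply: rho_inj => //; lia.
Qed.

Local Open Scope ring_scope.
Variable F : fieldType.
Let JS := jordan_nil F (sumn lam) (stair mu k.+1).
(** [JS] carried to the cells of [lam] along [g], hence similar to [JS]; [edge] describes its
    entries. *)
Let A1 := row_perm (perm gf_inj) (col_perm (perm gf_inj) JS).
Let edge (x y : nat) : F :=
  (if blk lam x < k then (y == x.+1) && (0 < coff lam x)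
   else (k <= blk lam y) && (rho y == (rho x).+1))%N%:R.

Let coffS x : (x < sumn lam)%N ->
  coff (stair mu k.+1) (g x) = if (blk lam x < k)%N then coff lam x else (m.-1 - rho x)%N.
Proof.
move=> xs; rewrite /g; have sS : sumn (stair mu k ++ [:: m]) = sumn lam.
  by rewrite cats1 -stairS sumn_lam.
rewrite stairS -cats1; case: (ltnP (blk lam x) k) => xk; last first.
  have rx := rho_lt xs xk.
  have [|_ []] := @cell_cat (stair mu k) [:: m] (n1 + rho x).
  - by rewrite sS sumnE; lia.
  - exact: leq_addr.
  by move=> _ _ ->; rewrite -/n1 addKn /=; case: ltnP; lia.
have x1 : (x < n1)%N by rewrite -blk_lt.
have [/(_ x1)[_ _ ->] _] := @cell_cat (stair mu k) [:: m] x (etrans (congr1 _ sS) xs).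
by have [/(_ x1)[_ _ ->] _] := cell_cat xs.
Qed.

Let A1E : A1 = \matrix_(x, y) edge x y.
Proof.
apply/matrixP => x y; rewrite [RHS]mxE 2![LHS]mxE !permE jordan_nilE -?sumn_lam // (coffS (ltn_ord x)).
rewrite /edge; congr (nat_of_bool _)%:R; rewrite [gf y : nat]/(g y) [gf x : nat]/(g x) /g.
case: (ltnP (blk lam x)) => xk; case: (ltnP (blk lam y)) => yk //.
- have x1 : (x < n1)%N by rewrite -blk_lt.
  have [/(_ x1)[_ _ ->] _] := cell_cat (ltn_ord x).
  have y1 : (n1 <= y)%N by rewrite leqNgt -blk_lt // -leqNgt.
  have := coff_bound x1; have := rho_lt (ltn_ord y) yk; rewrite -/n1; lia.
- have y1 : (y < n1)%N by rewrite -blk_lt.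
  by apply/negbTE; lia.
- by have := rho_lt (ltn_ord y) yk; rewrite /= eqn_leq; lia.
Qed.

(** On the first [k] parts [A1] is the Jordan matrix itself; on the rest it raises [rho] by 1, and
    the Jordan matrix is its [t]-th power. *)
Let A1_comm : A1 *m jordan_nil F _ lam = jordan_nil F _ lam *m A1.
Proof.
have t0 : (0 < t)%N by case/andP: ht.
rewrite A1E; apply: comm_jordan_nilP => //; rewrite /edge.
- move=> i j i' j' ei ej ci cj; congr (nat_of_bool _)%:R.
  have [i2 e2 [oi' ci' bi']] := next_cell erefl ci.
  have [j2 f2 [oj' cj' bj']] := next_cell erefl cj.
  rewrite e2 -ei in oi' ci' bi' => {i2 e2}; rewrite f2 -ej in oj' cj' bj' => {j2 f2}.
  rewrite /rho bi' bj' oi' oj' ci' !mulnS; case: ifP => ik; last by congr (_ && _); lia.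
  rewrite ci andbT ei ej eqSS; case: eqP => // e; move: cj; rewrite e -ei ci'; lia.
(* In the almost rectangular part a cell that does not start its row has [rho i >= t], and one that
   does has [rho j < t]. *)
- move=> i j oi oj; rewrite (_ : (if _ then _ else _) = false) //.
  case: ifP => ik; apply/negbTE/negP.
    by move=> /andP[/eqP ej ci]; move: oj; rewrite ej off_next ?ci // -ej.
  move=> /andP[jk]; rewrite /rho oj muln0.
  have cj : (blk lam j - k < t)%N by case: (ar_cell hk ht (ltn_ord j) jk).
  have : (t <= t * off lam i)%N by rewrite leq_pmulr.
  lia.
(* Here the end of a row gives [rho i + t >= m], whereas [j] is followed by a cell with number
   [rho j + t < m]. *)
move=> i j ci cj; rewrite (_ : (if _ then _ else _) = false) //.
rewrite ci andbF; case: ifP => // ik; apply/negbTE/negP => /andP[jk /eqP e].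
have ik' : (k <= blk lam i)%N by rewrite leqNgt ik.
have h : (m <= rho i + t)%N by case: (ar_level hk ht (ltn_ord i) ik') => _ /(_ ci).
have [j' ej [oj' _ bj']] := next_cell erefl cj.
have := rho_lt (ltn_ord j'); rewrite bj' => /(_ jk); move: e h.
rewrite /rho oj' bj' mulnS; lia.
Qed.

Let A1_shape : has_shape A1 (stair mu k.+1).
Proof.
split; first exact: is_partition_stairS.
split; first by rewrite sumn_lam.
exists (perm_mx (perm gf_inj)^-1); rewrite unitmx_perm; split=> //.
rewrite /A1 row_permE col_permE mulmxA; congr (_ *m _ *m _).
rewrite -[LHS]mul1mx -(mulVmx (unitmx_perm F (perm gf_inj)^-1)) -mulmxA -perm_mxM.
by rewrite mulVg perm_mx1 mulmx1.
Qed.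

(** Existence through [A1] and maximality are known for the Jordan matrix itself; conjugation
    carries both to any [B] of shape [lam]. *)
Lemma D_is_stair : D_is F lam (stair mu k.+1).
Proof.
split; first exact: is_partition_lam.
split; first exact: is_partition_stairS.
split; first by rewrite sumn_lam.
move=> B [_ [_ [P [uP EB]]]].
have uV : invmx P \in unitmx by rewrite unitmx_inv.
have EB' : B = invmx P *m jordan_nil F _ lam *m invmx (invmx P) by rewrite invmxK.
split.
  exists (invmx P *m A1 *m invmx (invmx P)); split; last exact: has_shape_conj.
  split; last by rewrite EB'; apply: comm_conj uV A1_comm.
  apply: nilpotent_conj => //.
  have nJ : nilpotent_mx JS by apply: nilpotent_jordan_nil; rewrite sumn_lam.
  have [_ [_ [Q [uQ ->]]]] := A1_shape.
  by rewrite -{2}[Q]invmxK; apply: nilpotent_conj; rewrite ?unitmx_inv.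
move=> nu [A [[nA AB] sA]].
apply: (@centralizer_dominated F (P *m A *m invmx P)); last exact: has_shape_conj.
  exact: nilpotent_conj.
have EJ : P *m B *m invmx P = jordan_nil F _ lam.
  by rewrite EB !mulmxA mulmxV // mul1mx mulmxK.
by have := comm_conj uP AB; rewrite EJ.
Qed.

End StairPreimage.

(** * Antichains and U-chains *)

Definition gap2 : rel nat := fun a b => b + 2 <= a.

Lemma gap2_nth l i j : sorted gap2 l -> i <= j < size l ->
  nth 0 l j + 2 * (j - i) <= nth 0 l i.
Proof.
move=> /(sortedP 0) sl /andP[]; elim: j => [|j IH]; first by case: i; rewrite ?addn0.
rewrite leq_eqVlt => /predU1P[<-|]; first by rewrite subnn addn0.
rewrite ltnS => ij jl; have := IH ij (ltnW jl); have := sl j jl; rewrite /gap2; lia.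
Qed.

(* Parts with gaps at least 2 carry an antichain of cells, one in each part. *)
Lemma gap2_rank (F : fieldType) n lam (A : 'M[F]_n) l :
  sumn lam = n -> nilpotent_mx A ->
  (A *m jordan_nil F n lam = jordan_nil F n lam *m A)%R ->
  all (leq 1) lam -> sorted gap2 l -> {subset l <= lam} ->
  \rank A + size l <= n.
Proof.
move=> hn nA com lam0 sl sub; have [P uP hP] := comm_jordan_nil_triangular hn nA com.
rewrite -(rank_conj_mx _ uP); move: (P *m A *m invmx P)%R hP => M hM {P uP A nA com}.
(* Passing to a larger part raises [off] by 1 per step, and the gaps of at least 2 then raise [coff]
   as well, so these cells are pairwise incomparable. *)
pose e (i : 'I_(size l)) := ((size l).-1 - i)%N; pose d (i : 'I_(size l)) := ((nth 0 l i).-1 - e i)%N.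
have big_enough (i : 'I_(size l)) : 2 * e i < nth 0 l i.
  have rl : (size l).-1 < size l by have := ltn_ord i; lia.
  have ir : i <= (size l).-1 < size l by rewrite rl andbT; have := ltn_ord i; lia.
  have := gap2_nth sl ir; have := allP lam0 _ (sub _ (mem_nth 0 rl)); rewrite /e /=; lia.
have gap (i j : 'I_(size l)) : i <= j -> nth 0 l j + 2 * (j - i) <= nth 0 l i.
  by move=> ij; apply: gap2_nth => //; rewrite ij ltn_ord.
(* Cells with equal distances are ordered by index, so the least index gives the minimal one. *)
have /fin_all_exists[c hc] (i : 'I_(size l)) : exists x : 'I_n,
    [/\ off lam x = e i, coff lam x = d i &
     forall y : 'I_n, off lam y = e i -> coff lam y = d i -> x <= y].
  have ex : exists x, [&& x < n, off lam x == e i & coff lam x == d i].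
    have al : nth 0 l i \in lam by apply/sub/mem_nth; exact: ltn_ord.
    have [|x [xn xo xc]] := @cell_exists lam (e i) (nth 0 l i) al.
      by have := big_enough i; lia.
    by exists x; rewrite -hn xn xo xc !eqxx.
  case: (ex_minnP ex) => x /and3P[xn /eqP xo /eqP xc] xmin.
  by exists (Ordinal xn); split=> // y yo yc; apply: xmin; rewrite ltn_ord yo yc !eqxx.
pose U := [set y : 'I_n | [exists i : 'I_(size l), (e i <= off lam y) && (coff lam y <= d i)]].
pose C := [set c i | i : 'I_(size l)].
have CU : C \subset U.
  apply/subsetP => _ /imsetP[i _ ->]; rewrite inE; apply/existsP; exists i.
  by case: (hc i) => -> ->; rewrite !leqnn.
have cC : #|C| = size l.
  rewrite card_imset ?card_ord // => i j cij; apply: val_inj => /=.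
  have [h1 _ _] := hc i; have [h2 _ _] := hc j; move: h2; rewrite -cij h1 /e /=.
  by have := ltn_ord i; have := ltn_ord j; lia.
(* [U] is the upper set generated by the antichain [C]: a nonzero entry with row in [U] has its
   column in [U], but not at a minimal element, that is, not in [C]. *)
have : \rank M <= #|~: U| + #|U :\: C|.
  apply: rank_zero_block => x y /hM /and3P[h1 h2 h3]; rewrite !inE.
  case: existsP => //= -[i /andP[ei di]]; apply/andP; split; last first.
    by apply/existsP; exists i; rewrite (leq_trans ei h1) (leq_trans h2 di).
  apply/imsetP => -[j _ yj]; have [cj1 cj2 cj3] := hc j; rewrite -yj in cj1 cj2 cj3.
  have ij : i = j :> nat.
    have := gap i j; have := gap j i; have := big_enough i; have := big_enough j.
    by move: ei di h1 h2; rewrite cj1 cj2 /d /e /=; have := ltn_ord i; have := ltn_ord j; lia.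
  have {}ij : i = j by apply: val_inj.
  rewrite ij in ei di.
  have : x < y by apply: (implyP h3); lia.
  by rewrite ltnNge cj3 //; lia.
have := cardsC U; rewrite card_ord => hU.
have := cardsID C U; rewrite (setIidPr CU) cC; lia.
Qed.

(** * The 0/1 matrix of a strict order and its powers *)

Section OrderMatrix.
Variables (F : fieldType) (charF0 : [pchar F]%R =i pred0) (n : nat) (lt : rel 'I_n).
Hypotheses (lt_irr : irreflexive lt) (lt_trans : transitive lt).
Local Open Scope ring_scope.

Definition order_mx : 'M[F]_n := \matrix_(x, y) (lt x y)%:R.

Let height x := #|[set z | lt z x]|.

Let height_lt x y : lt x y -> (height x < height y)%N.
Proof.
move=> xy; apply: proper_card; apply/properP; split.
  by apply/subsetP => z; rewrite !inE => /lt_trans; apply.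
by exists x; rewrite !inE ?lt_irr.
Qed.

(** The number of elements below [x] strictly increases along the order and stays below [n], so
    levels 0 to [n] leave rank 0 for the [n]-th power. *)
Lemma order_mx_nilpotent : nilpotent_mx order_mx.
Proof.
exists n; apply/eqP; rewrite -mxrank_eq0 -leqn0.
have := @strict_level_rank F n order_mx height 0 n _ (leq0n n); rewrite subn0.
move=> h; apply: leq_trans (h _) _.
  by move=> x y; rewrite mxE; case xy: (lt x y); rewrite ?eqxx //; rewrite height_lt.
rewrite leqn0 addn_eq0 !cards_eq0; apply/andP; split; apply/eqP/setP => x; rewrite !inE //.
apply/negbTE; rewrite -ltnNge -[X in (_ < X)%N](card_ord n) -cardsT.
apply: proper_card; apply/properP; split; first exact: subsetT.
by exists x; rewrite !inE ?lt_irr.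
Qed.

Fixpoint walks L (x y : 'I_n) : nat :=
  if L is L'.+1 then (\sum_(z | lt x z) walks L' z y)%N else x == y.

Lemma order_mxX L x y : (order_mx ^+ L) x y = (walks L x y)%:R.
Proof.
elim: L x => [|L IH] x; first by rewrite expr0 mxE.
rewrite exprS mxE /= natr_sum [RHS]big_mkcond; apply: eq_bigr => z _.
by rewrite mxE IH; case: ifP; rewrite ?mul1r ?mul0r.
Qed.

(** Entries of the power count walks with [L] steps, and in characteristic 0 a positive count is
    nonzero. A walk is built by induction through the chain. *)
Lemma chain_order_mx L (K : {set 'I_n}) : (L < #|K|)%N ->
  {in K &, forall x y, x != y -> lt x y || lt y x} -> order_mx ^+ L != 0.
Proof.
suff H L' (K' : {set 'I_n}) : (L' < #|K'|)%N ->
    {in K' &, forall x y, x != y -> lt x y || lt y x} ->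
    exists2 x, x \in K' & exists y, (0 < walks L' x y)%N.
  move=> LK totK; have [x _ [y xy]] := H L K LK totK.
  apply/eqP => /matrixP/(_ x y); rewrite order_mxX mxE => /eqP.
  have /pcharf0P -> := charF0; by rewrite -leqn0 leqNgt xy.
elim: L' K' => [|L' IH] K' LK totK.
  have /card_gt0P[x xK] := LK; by exists x => //; exists x; rewrite /= eqxx.
have /card_gt0P[x0 x0K] : (0 < #|K'|)%N by apply: leq_ltn_trans LK.
(* The lowest element of the chain is put in front of a walk that starts in the rest of the
   chain. *)
case: (arg_minnP height x0K) => x xK xmin; exists x => //.
have [||z zK [y zy]] := IH (K' :\ x).
- by move: LK; rewrite (cardsD1 x) [_ \in _]xK.
- by move=> a b; rewrite !inE => /andP[_ aK] /andP[_ bK]; apply: totK.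
move: zK; rewrite !inE => /andP[zx zK]; exists y => /=.
have xz : lt x z.
  have /orP[|//] := totK z x zK xK zx; move/height_lt; by rewrite ltnNge xmin.
by rewrite (bigD1 z) //= addn_gt0 zy.
Qed.

End OrderMatrix.

Lemma cell_lt_irr lam x : cell_lt lam x x = false.
Proof. by rewrite /cell_lt !leqnn ltnn. Qed.

Lemma cell_lt_trans lam : transitive (cell_lt lam).
Proof. by move=> y x z; rewrite /cell_lt; lia. Qed.

Section CellOrder.
Variables (F : fieldType) (n : nat) (lam : seq nat).
Hypothesis hn : sumn lam = n.

Definition cell_order_mx : 'M[F]_n := order_mx F (fun x y : 'I_n => cell_lt lam x y).

(** Moving both cells one place on changes both values of [off], of [coff] and of the index equally,
    so the order between them is kept; the border conditions hold because [off] grows and [coff]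
    falls along the order. *)
Lemma cell_order_mx_comm :
  (cell_order_mx *m jordan_nil F n lam = jordan_nil F n lam *m cell_order_mx)%R.
Proof.
apply: (@comm_jordan_nilP _ _ _ hn (fun x y => (cell_lt lam x y)%:R)%R).
- move=> i j i' j' ei ej ci cj.
  have [i2 e2 [oi' ci' _]] := next_cell hn ci.
  have [j2 f2 [oj' cj' _]] := next_cell hn cj.
  rewrite e2 -ei in oi' ci' => {i2 e2}; rewrite f2 -ej in oj' cj' => {j2 f2}.
  congr (nat_of_bool _)%:R%R; rewrite /cell_lt oi' ci' oj' cj' ei ej; lia.
- by move=> i j oi oj; rewrite /cell_lt oj leqNgt oi.
by move=> i j ci cj; rewrite /cell_lt ci (leqNgt (coff lam j)) cj andbF.
Qed.

Lemma cell_order_mx_nilpotent : nilpotent_mx cell_order_mx.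
Proof.
apply: order_mx_nilpotent; first by move=> x; apply: cell_lt_irr.
by move=> x y z; apply: cell_lt_trans.
Qed.

(* The number of cells of a part p in the U-chain at q. *)
Definition uchain_weight q p :=
  if q <= p <= q.+1 then p else if q.+1 < p then 2 else 0.

(** The cells of the U-chain form a chain: sums [off + coff] that differ by at most 1 make two cells
    of the parts [q] and [q.+1] comparable, while first cells of larger parts lie below them and
    last cells above. *)
Lemma cell_order_mx_neq0 (charF0 : [pchar F]%R =i pred0) q L :
  L < \sum_(p <- lam) uchain_weight q p -> (cell_order_mx ^+ L != 0)%R.
Proof.
move=> hL; pose inK o c := let s := (o + c).+1 in
  (q <= s <= q.+1) || ((q.+1 < s) && ((o == 0) || (c == 0))).
pose K := [set x : 'I_n | inK (off lam x) (coff lam x)].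
apply: (@chain_order_mx F charF0 n _ _ _ L K).
- by move=> x; apply: cell_lt_irr.
- by move=> x y z; apply: cell_lt_trans.
- apply: leq_trans hL _; rewrite -sum1_card [X in _ <= X]big_mkcond /=.
  apply: (@leq_trans (\sum_(x < n) inK (off lam x) (coff lam x))); last first.
    by apply: leq_sum => x _; rewrite inE; case: (inK _ _).
  have := cell_sum_parts lam (fun o c => inK o c : nat); rewrite hn => ->.
  apply: leq_sum => p _.
  have E (e : 'I_p) : inK e (p.-1 - e) =
      (q <= p <= q.+1) || ((q.+1 < p) && ((e == 0 :> nat) || (p.-1 - e == 0))).
    rewrite /inK; have -> : (e + (p.-1 - e)).+1 = p by have := ltn_ord e; lia.
    by [].
  rewrite (eq_bigr _ (fun e _ => congr1 nat_of_bool (E e))) /uchain_weight.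
  case: ifP => // hp; first by rewrite sum_nat_const card_ord muln1.
  case: (ltnP q.+1 p) => // qp.
  have p0 : 0 < p by lia.
  have pp : p.-1 < p by lia.
  rewrite (bigD1 (Ordinal p0)) //= (bigD1 (Ordinal pp)) /=; last by rewrite -val_eqE /=; lia.
  by rewrite subnn !eqxx orbT.
move=> x y; rewrite !inE /inK /cell_lt -val_eqE /=; lia.
Qed.

End CellOrder.

Lemma jordan_nilX_eq0 (F : fieldType) n nu a : sumn nu = n -> is_partition nu ->
  head 0 nu <= a -> (jordan_nil F n nu ^+ a = 0)%R.
Proof.
move=> hn /andP[snu _] ha; apply/matrixP => i j; rewrite jordan_nilXE // mxE.
rewrite (_ : (a <= coff nu i) = false) ?andbF //; apply/negbTE; rewrite -ltnNge.
have [|E bl] := @cell_size nu i; first by rewrite hn.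
have : nth 0 nu (blk nu i) <= nth 0 nu 0.
  have tr : transitive geq by move=> y x z /= xy yz; apply: leq_trans yz xy.
  apply: (sorted_leq_nth tr (fun x => leqnn x) 0 snu) => //; rewrite inE //.
  exact: leq_ltn_trans bl.
by rewrite nth0; lia.
Qed.

(** The shape of the cell order matrix is dominated by [mu], so its power [head 0 mu] vanishes; a
    longer U-chain would make that power nonzero. *)
Lemma uchain_bound (F : fieldType) (charF0 : [pchar F]%R =i pred0) lam mu q :
  D_is F lam mu -> \sum_(p <- lam) uchain_weight q p <= head 0 mu.
Proof.
move=> [plam [pmu [smu H]]].
have sJ : has_shape (jordan_nil F (sumn lam) lam) lam.
  by split=> //; split=> //; exists 1%:M%R; rewrite unitmx1 invmx1 mul1mx mulmx1.
have [_ dom] := H _ sJ.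
have nC := @cell_order_mx_nilpotent F (sumn lam) lam.
have [nu snu] := has_shape_exists nC.
have := dom nu; move=> /(_ _)/(_ 1) h; have {h} h : head 0 nu <= head 0 mu.
  have /h : exists A, in_NB (jordan_nil F (sumn lam) lam) A /\ has_shape A nu.
    exists (cell_order_mx F (sumn lam) lam); split=> //; split=> //.
    exact: cell_order_mx_comm.
  by case: (nu) => [//|? ?]; case: (mu) => [|? ?]; rewrite /= ?take0 ?addn0.
rewrite leqNgt; apply/negP => /(cell_order_mx_neq0 erefl charF0); apply/negP; rewrite negbK.
have [pnu [hnu _]] := snu.
by rewrite -mxrank_eq0 (rank_expmx_shape _ snu) jordan_nilX_eq0 ?mxrank0.
Qed.

(** * The greedy cover by almost rectangular groups *)

Lemma geq_trans : transitive geq.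
Proof. by move=> y x z /= xy yz; apply: leq_trans yz xy. Qed.

Lemma sorted_geq_split s a : sorted geq s ->
  s = [seq x <- s | a <= x] ++ [seq x <- s | x < a].
Proof.
elim: s => //= p s IH ps; have {}IH := IH (path_sorted ps); case: leqP => pa /=.
  by rewrite -IH.
have h : all (fun x => x < a) s.
  move: ps; rewrite (path_sortedE geq_trans) => /andP[/allP h _].
  by apply/allP => x /h /= xp; apply: leq_ltn_trans pa.
rewrite (all_filterP h); have -> // : [seq x <- s | a <= x] = [::].
apply/eqP; rewrite -[_ == _]negbK -has_filter; apply/hasPn => x xs.
by rewrite -ltnNge (allP h).
Qed.

(** The parts take the values [b] and [b.+1], where [b] is the last part. As [b] occurs, fewer than
    [t] parts equal [b.+1], so [b] and their number are quotient and remainder of [m] by [t]. *)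
Lemma almost_rect_ar m t p : 0 < t -> almost_rect m t p -> p = ar m t.
Proof.
move=> t0 [/andP[sp _] [sm [st hd]]].
have p0 : p != [::] by rewrite -size_eq0 st -lt0n.
set b := last 0 p in hd.
have ub x : x \in p -> b <= x <= b.+1.
  move=> xp; have := sorted_leq_nth geq_trans (fun x => leqnn x) 0 sp => h.
  have it : index x p < t by rewrite -st index_mem.
  have := h 0 (index x p); have := h (index x p) (size p).-1.
  rewrite !inE nth_index // nth_last nth0 st prednK // => h1 h2.
  have h3 : x <= head 0 p := h2 t0 it isT.
  have h4 : b <= x by apply: h1; rewrite // -ltnS prednK.
  by move: hd; lia.
have [e1 e2] : [seq x <- p | b < x] = nseq (count (leq b.+1) p) b.+1 /\
               [seq x <- p | x < b.+1] = nseq (count (fun x => x < b.+1) p) b.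
  split; rewrite -size_filter; apply/all_pred1P/allP => x; rewrite mem_filter => /andP[h /ub h'] /=; lia.
have E := sorted_geq_split b.+1 sp; rewrite e1 e2 in E.
set s := count (leq b.+1) p in E; set u := count _ p in E.
have su : s + u = t by rewrite -st [in RHS]E size_cat !size_nseq.
have u0 : 0 < u.
  rewrite -has_count; apply/hasP; exists b => //.
  by rewrite /b; case: (p) p0 => //= x q _; apply: mem_last.
have sE : b * t + s = m by rewrite -sm E sumn_cat !sumn_nseq -su; nia.
have st' : s < t by lia.
rewrite E /ar; have -> : m %/ t = b by rewrite -sE divnMDl // divn_small // addn0.
have -> : m %% t = s by rewrite -sE modnMDl modn_small.
by rewrite -su addKn.
Qed.

Lemma stair_cons mu k : stair mu k.+1 = mu :: stair (mu - 2) k.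
Proof.
rewrite /stair /= muln0 subn0 (iotaDl 1) -map_comp; congr (_ :: _).
by apply: eq_map => i /=; rewrite mulnDr subnDA.
Qed.

Lemma sumn_bigE s : sumn s = \sum_(p <- s) p.
Proof. by elim: s => [|p s IH]; rewrite ?big_nil ?big_cons //= IH. Qed.

(* Groups the parts greedily from the largest down, each group consisting of all
   remaining parts that are at least its largest part minus 1, and adds up the
   bounds given by the U-chains. *)
Lemma greedy_cover lam M : is_partition lam ->
  (forall q, \sum_(p <- lam) uchain_weight q p <= M) ->
  exists l, [/\ sorted gap2 l, {subset l <= lam},
    sumn lam + size l * (size l).-1 <= size l * M &
    sumn lam + size l * (size l).-1 = size l * M -> 0 < size l ->
      exists2 p, lam = stair M (size l).-1 ++ p &
        0 < size p /\ almost_rect (M - 2 * (size l).-1) (size p) p].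
Proof.
have [N] := ubnP (size lam); elim: N lam M => // N IH [|P rest] M lN plam wM.
  by exists [::]; split.
move: (plam) lN wM => /andP[sl pl]; set lam := P :: rest in plam sl pl * => lN wM.
have P0 : 0 < P by case/andP: pl.
have Pmax x : x \in lam -> x <= P.
  rewrite inE => /predU1P[->//|xr]; move: sl; rewrite /= (path_sortedE geq_trans).
  by case/andP => /allP/(_ _ xr).
have split_lam := sorted_geq_split P.-1 sl.
set G := [seq x <- lam | P.-1 <= x] in split_lam; set lam' := [seq x <- lam | x < P.-1] in split_lam.
have G0 : 0 < size G by rewrite /G /= leq_pred.
have sG : sorted geq G by apply: sorted_filter sl; apply: geq_trans.
have Gx x : x \in G -> P.-1 <= x <= P by rewrite mem_filter => /andP[-> /Pmax ->].
have lamx x : x \in lam' -> 0 < x < P.-1.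
  by rewrite mem_filter => /andP[-> /(allP pl) ->].
have sumE : sumn lam = sumn G + sumn lam' by rewrite split_lam sumn_cat.
have wE q : \sum_(p <- lam) uchain_weight q p =
    \sum_(p <- G) uchain_weight q p + \sum_(p <- lam') uchain_weight q p.
  by rewrite split_lam big_cat.
(* The U-chain at [q = P - 1] contains every cell of the first group. *)
have GM : sumn G <= M.
  apply: leq_trans (wM P.-1); rewrite wE; apply: leq_trans (leq_addr _ _).
  rewrite sumn_bigE big_seq [X in _ <= X]big_seq; apply: leq_sum => x /Gx.
  by rewrite /uchain_weight prednK // => ->.
have pG : is_partition G.
  by rewrite /is_partition sG; apply/allP => x; rewrite mem_filter => /andP[_ /(allP pl)].
have [E|l'0] := eqVneq lam' [::].
  exists [:: P]; rewrite [size _]/= [1.-1]/= muln0 addn0 mul1n; split=> //.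
  - by move=> x; rewrite !inE => ->.
  - by rewrite sumE E addn0.
  rewrite muln0 subn0 => eM _; exists lam => //; split=> //.
  split=> //; split; first by rewrite -eM.
  split=> //; have lG : lam = G by rewrite split_lam E cats0.
  have : last 0 lam \in G by rewrite -lG /lam /= mem_last.
  by move/Gx => /=; lia.
have [y yl] : exists y, y \in lam' by case: (lam') l'0 => // y ? _; exists y; rewrite mem_head.
have P3 : 2 < P by have := lamx _ yl; lia.
have wG q : q.+1 < P.-1 -> \sum_(p <- G) uchain_weight q p = 2 * size G.
  move=> qP; rewrite big_seq (eq_bigr (fun=> 2)) => [|x /Gx xG].
    by rewrite -big_seq big_const_seq count_predT iter_addn_0.
  by rewrite /uchain_weight ifN ?ifT //; lia.
(* Each part of [G] adds its two end cells to every U-chain at a lower [q]. For larger [q], the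
   U-chain at [P - 3] has at least as many cells in [lam'], whose parts are at most [P - 2]. *)
have wM' q : \sum_(p <- lam') uchain_weight q p + 2 * size G <= M.
  case: (ltnP q.+1 P.-1) => qP; first by rewrite addnC -(wG q qP) -wE.
  have qP3 : (P - 3).+1 < P.-1 by lia.
  apply: leq_trans (wM (P - 3)); rewrite wE (wG _ qP3) addnC leq_add2l.
  rewrite big_seq [X in _ <= X]big_seq; apply: leq_sum => x /lamx xl.
  rewrite /uchain_weight; case: ifP => h1; first by rewrite ifT //; lia.
  by rewrite ifN //; lia.
have [|||l [sl' subl le eqc]] := IH lam' (M - 2 * size G).
- have : size lam = size G + size lam' by rewrite split_lam size_cat.
  by move: lN; rewrite /lam /=; lia.
- rewrite /is_partition sorted_filter //; last exact: geq_trans.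
  by apply/allP => x /lamx/andP[].
- by move=> q; have := wM' q; lia.
have GM2 : 2 * size G <= M by have := wM' 0; lia.
have lam'0 : 0 < sumn lam'.
  have := lamx _ yl; move: yl; rewrite -has_pred1 sumn_bigE => /hasP[z zl /eqP <-].
  by rewrite (big_rem z) //=; lia.
have l0 : 0 < size l by case: (l) le => //=; lia.
exists (P :: l); split.
- rewrite /= path_min_sorted //; apply/allP => x /subl /lamx; rewrite /gap2; lia.
- move=> x; rewrite inE => /predU1P[->|/subl]; first exact: mem_head.
  by rewrite mem_filter => /andP[].
(* With [r = size l], the left side gains an extra [2 * r], which is paid for by the loss of
   [2 * size G] in each of the [r] remaining bounds. *)
- rewrite sumE [size (P :: l)]/= [_.+1.-1]/=; move: le GM l0 G0 GM2; move: (size l) (size G) (sumn G) (sumn lam') => r g sG' sl''.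
  by case: r => // r le GM _ G0 GM2; nia.
rewrite sumE [size (P :: l)]/= [_.+1.-1]/= => E _.
(* Equality leaves no slack: the loss [2 * size G] per remaining group must be exactly 2, and both
   partial bounds must be attained. *)
have [g1 [GE lE]] : size G = 1 /\ sumn G = M /\
    sumn lam' + size l * (size l).-1 = size l * (M - 2 * size G).
  move: E le GM l0 G0 GM2; move: (size l) (size G) (sumn G) (sumn lam') => r g sG' sl''.
  case: r => // r E le GM _ G0 GM2.
  have h1 : r.+1 * (2 * g) + r.+1 * (M - 2 * g) = r.+1 * M by rewrite -mulnDr subnKC.
  have h2 : r.+1 * 2 <= r.+1 * (2 * g) by rewrite leq_mul2l; lia.
  have h3 : r.+1 * 2 = r.+1 * (2 * g) by move: E h1 le h2; rewrite /= !mulSn; nia.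
  have g1 : g = 1 by move/eqP: h3; rewrite eqn_mul2l /=; lia.
  by split=> //; split; move: E h1 le h2; rewrite /= !mulSn; nia.
have GP : G = [:: M].
  by move: g1 GE; case: (G) => // x [|] //= _; rewrite addn0 => ->.
have [p lamE [sp ap]] := eqc lE l0.
rewrite g1 in lamE ap; exists p; last first.
  split=> //; move: ap; have -> // : M - 2 * 1 - 2 * (size l).-1 = M - 2 * size l by lia.
rewrite split_lam GP lamE -[in RHS](prednK l0) stair_cons //.
Qed.

(** * The preimages of the staircase and their number *)

Lemma sum_predn s : all (leq 1) s -> \sum_(p <- s) (p - 1) + size s = sumn s.
Proof.
elim: s => [|p s IH] /=; first by rewrite big_nil.
by case/andP => p0 /IH <-; rewrite big_cons; lia.
Qed.

(** An [A] of staircase shape has rank at least [n - (k + 1)], while the antichain of largest parts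
    allows at most [n - size l]. So the greedy cover has at most [k + 1] groups, and its inequality
    then forces equality. *)
Lemma D_is_stair_inv (F : fieldType) (charF0 : [pchar F]%R =i pred0) mu k lam :
  2 * k < mu -> D_is F lam (stair mu k.+1) ->
  exists2 p, lam = stair mu k ++ p & 0 < size p /\ almost_rect (mu - 2 * k) (size p) p.
Proof.
move=> hk D; have uc q := uchain_bound charF0 q D.
have [plam [pst [sumE H]]] := D.
have sJ : has_shape (jordan_nil F (sumn lam) lam) lam.
  by split=> //; split=> //; exists 1%:M%R; rewrite unitmx1 invmx1 mul1mx mulmx1.
have [[A [[nA com] sA]] _] := H _ sJ.
have hd : head 0 (stair mu k.+1) = mu by rewrite stair_cons.
have [l [sl subl le eqc]] := greedy_cover plam (M := mu) (fun q => leq_trans (uc q) (eq_leq hd)).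
have pos : all (leq 1) lam by case/andP: plam.
have := gap2_rank erefl nA com pos sl subl.
have := rank_jordan_nilX F 1 sumE; rewrite -(rank_expmx_shape 1 sA) expr1.
have := @sum_predn (stair mu k.+1); case/andP: pst => _ -> /(_ isT).
rewrite size_stair sumE => h1 h2 h3.
have h4 : size l <= k.+1 by lia.
have sumlam : sumn lam = k.+1 * (mu - k) by rewrite -sumE sumn_stair //; lia.
(* With [r = size l] the greedy inequality reads [sumn lam <= r * (mu + 1 - r)]. The right side
   strictly increases up to [r = k.+1] because [2 * k < mu], and equals [sumn lam] there. *)
have lk : size l = k.+1.
  move: le h4; rewrite sumlam; case: (size l) => [|r] /=; first by nia.
  by move=> le; rewrite ltnS leq_eqVlt => /predU1P[->//|rk]; nia.
have [||p lamE hp] := eqc; rewrite ?lk //; first by rewrite sumlam /=; nia.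
by rewrite lk /= in lamE hp; exists p.
Qed.

Theorem theorem4p1 (F : closedFieldType) (charF0 : [pchar F]%R =i pred0)
    (mu k : nat) (hk : 2 * k < mu) :
  (forall lam : seq nat,
     D_is F lam [seq mu - 2 * i | i <- iota 0 k.+1] <->
     exists t, exists2 p : seq nat,
       (1 <= t <= mu - 2 * k) /\ almost_rect (mu - 2 * k) t p &
       lam = [seq mu - 2 * i | i <- iota 0 k] ++ p) /\
  (exists s : seq (seq nat),
     [/\ uniq s, size s = mu - 2 * k &
         forall lam, lam \in s <-> D_is F lam [seq mu - 2 * i | i <- iota 0 k.+1]]).
Proof.
have main lam : D_is F lam (stair mu k.+1) <-> exists t, exists2 p : seq nat,
    (1 <= t <= mu - 2 * k) /\ almost_rect (mu - 2 * k) t p & lam = stair mu k ++ p.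
  split=> [/(D_is_stair_inv charF0 hk)[p lamE [p0 ap]]|[t [p [ht ap] ->]]].
    exists (size p), p => //; split=> //; rewrite p0 /=.
    case: ap => /andP[_ pos] [<- _].
    by elim: (p) pos => //= x q IH /andP[x0 /IH]; lia.
  have t0 : 0 < t by case/andP: ht.
  by rewrite (almost_rect_ar t0 ap); apply: D_is_stair.
split=> //; exists [seq stair mu k ++ ar (mu - 2 * k) t | t <- iota 1 (mu - 2 * k)].
split; last 1 first.
- move=> lam; split.
    by case/mapP => t; rewrite mem_iota => ht ->; apply: D_is_stair => //; lia.
  case/main => t [p [ht ap] ->]; apply/mapP; exists t; first by rewrite mem_iota; lia.
  by rewrite (almost_rect_ar _ ap) //; case/andP: ht.
(* Members for different [t] have different lengths [k + t]. *)
- rewrite map_inj_in_uniq ?iota_uniq // => t u; rewrite !mem_iota => ht hu /(congr1 size).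
  by rewrite 2!(size_cat (stair mu k)) !size_ar; lia.
- by rewrite size_map size_iota.
Qed.
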